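(* A team of $3$ co-located, synchronous agents is necessary and sufficient to solve PerpExploration-BBH on a ring $R$ with $n$ nodes under the pebble model of communication, with the presence of two pebbles initially co-located with the agents.
   Context: Model. $R=\{v_0,\dots,v_{n-1}\}$ is an oriented ring with unlabeled nodes; node $v_i$ has two ports, leading to $v_{(i-1)\bmod n}$ and $v_{(i+1)\bmod n}$, consistently labeled left and right. A set of $k$ agents operates in $R$. The agents know the underlying topology $R$ (in particular $n$), have unique IDs of $O(\log k)$ bits from $[0,k^c]$ ($c$ a constant), have $O(\log n)$ bits of internal memory, and all execute the same algorithm. ''Co-located'' means that all agents start at one common node, called home. Time proceeds in synchronous rounds; in each round every agent at a node $v$ takes a snapshot (the two ports, the number of pebbles at $v$, its own memory, the IDs of the other agents at $v$), and then performs a communication step and a move step (it may move through a port, being at the corresponding neighbour in the next round). Agents concurrently passing through the same edge do not notice each other. Pebble model: pebbles are identical movable tokens. An agent can pick up a pebble at its current node (under fair mutual exclusion), carry it from one node to another, and drop it at a node; agents perceive the pebbles present at their current node and the IDs of the agents co-located with them. Byzantine black hole. Exactly one node $v_b$ of $R$ is a Byzantine black hole; all other nodes are safe. Its position is fixed and unknown to the agents, and the starting node of the agents is safe. An adversary decides, at the beginning of each round, whether the black hole nature of $v_b$ is active during that round. If active, any agent at $v_b$ is destroyed without leaving any trace, and the adversary may also choose to destroy the information (pebbles) present at $v_b$. If not active, $v_b$ behaves like any safe node. PerpExploration-BBH: given a ring $R$ with $n$ nodes, one of which ($v_b$) is a Byzantine black hole, and a set of agents positioned on $R$, the agents must move so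 that each node of $R$ except $v_b$ is visited by at least one agent infinitely often.
   Formalization: Sufficiency is stated for rings with n ≥ 3 nodes and necessity of 3 agents for n ≥ 4: for n = 3 two agents suffice (one waits at home, the other alternates between the two neighbours, so its failure to return locates the black hole), and n < 3 is degenerate. *)

(* Defs.v *)
From mathcomp Require Export all_boot all_fingroup.

Set Implicit Arguments.
Unset Strict Implicit.
Unset Printing Implicit Defensive.

(* The nodes of the oriented ring of size n are 'I_n; the right port of v leads
   to ordS v, i.e. v + 1 mod n, and the left port to ord_pred v.  Node names
   are never visible to the agents. *)
Inductive direction := Stay | GoLeft | GoRight.

Definition neighbour n (v : 'I_n) (d : direction) : 'I_n :=
  match d with
  | Stay => v
  | GoLeft => ord_pred v
  | GoRight => ordS v
  end.

Inductive pebble_op := NoOp | PickUp | Drop.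

(* IDs of a team of k agents: the integers of [0, k^c]. *)
Notation agent_id k c := 'I_(k ^ c).+1.

(* The snapshot of an agent, apart from its own memory and its own ID.  Every
   node has the same two ports, so these carry no information.  Carried
   pebbles are not counted in [pebbles_seen]. *)
Record view (k c : nat) := View {
  pebbles_seen : nat;
  ids_seen : {set agent_id k c};
  holding : bool
}.

(* The program common to all the agents.  The communication step is computed
   from the snapshot; the move step and the new memory are computed from the
   snapshot and from whether the agent holds a pebble after the communication
   step (a pick-up may fail for lack of pebbles). *)
Record algorithm (k c : nat) := Algorithm {
  memory : finType;
  init_memory : memory;
  communicate : agent_id k c -> memory -> view k c -> pebble_op;
  move_step : agent_id k c -> memory -> view k c -> bool -> memory * direction
}.

(* O(log n) bits of memory, for a family of algorithms indexed by the size of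
   the ring (which the agents know): b bits have 2 ^ b configurations. *)
Definition log_memory (k c : nat) (A : nat -> algorithm k c) : Prop :=
  exists C : nat, forall n : nat, 1 < n -> #|memory (A n)| <= 2 ^ (C * up_log 2 n).

(* An agent carries at most one pebble at a time. *)
Record agent_state (n : nat) (M : Type) := AgentState {
  position : 'I_n;
  internal : M;
  carries : bool
}.

(* [agents i] is None once agent i has been destroyed; [pebbles v] is the number
   of pebbles lying at v. *)
Record config (n k : nat) (M : Type) := Config {
  agents : 'I_k -> option (agent_state n M);
  pebbles : 'I_n -> nat
}.

Definition at_node n k M (cf : config n k M) (i : 'I_k) (v : 'I_n) : bool :=
  if agents cf i is Some s then position s == v else false.

(* [active t]: the black hole is active during round t; [erase t]: it then also
   destroys the pebbles lying at its node (irrelevant when not active).  As the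
   agents are deterministic, adaptive adversaries are covered by quantifying
   over all such sequences of decisions. *)
Record adversary := Adversary {
  active : nat -> bool;
  erase : nat -> bool
}.

(* A pebble carried by a destroyed agent disappears with it. *)
Definition strike n k M (vb : 'I_n) (adv : adversary) (t : nat)
    (cf : config n k M) : config n k M :=
  Config
    (fun i => if active adv t && at_node cf i vb then None else agents cf i)
    (fun v => if [&& active adv t, erase adv t & v == vb] then 0
              else pebbles cf v).

(* Mutual exclusion on the pebbles of a node: in round t, agent i gets access
   before agent j when arb t i < arb t j.  Fairness: no agent has from some
   round on priority over another one. *)
Definition fair_arbitration k (arb : nat -> 'S_k) : Prop :=
  forall i j : 'I_k, i != j ->
  forall T : nat, exists t : nat, T <= t /\ arb t i < arb t j.

Section Round.

Variables (n k c : nat) (A : algorithm k c) (ids : 'I_k -> agent_id k c).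

Local Notation cfg := (config n k (memory A)).
Local Notation state := (agent_state n (memory A)).

Definition view_of (cf : cfg) (i : 'I_k) (s : state) : view k c :=
  View (pebbles cf (position s))
       [set ids j | j : 'I_k & (j != i) && at_node cf j (position s)]
       (carries s).

Definition op_of (cf : cfg) (i : 'I_k) (s : state) : pebble_op :=
  communicate (ids i) (internal s) (view_of cf i s).

Definition requests (cf : cfg) (i : 'I_k) (v : 'I_n) : bool :=
  if agents cf i is Some s then
    [&& position s == v, ~~ carries s &
        if op_of cf i s is PickUp then true else false]
  else false.

(* The requests at v concern the pebbles seen at v in the snapshot, and are
   served in the order of priority p as long as pebbles remain. *)
Definition picks (p : 'S_k) (cf : cfg) (i : 'I_k) (v : 'I_n) : bool :=
  requests cf i v &&
  (#|[set j : 'I_k | requests cf j v && (p j < p i)]| < pebbles cf v).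

Definition drops (cf : cfg) (i : 'I_k) (v : 'I_n) : bool :=
  if agents cf i is Some s then
    [&& position s == v, carries s &
        if op_of cf i s is Drop then true else false]
  else false.

Definition agent_step (p : 'S_k) (cf : cfg) (i : 'I_k) (s : state) : state :=
  let v := position s in
  let h := picks p cf i v || (carries s && ~~ drops cf i v) in
  let r := move_step (ids i) (internal s) (view_of cf i s) h in
  AgentState (neighbour v r.2) r.1 h.

Definition team_step (p : 'S_k) (cf : cfg) : cfg :=
  Config
    (fun i => omap (agent_step p cf i) (agents cf i))
    (fun v => pebbles cf v - #|[set i | picks p cf i v]|
              + #|[set i | drops cf i v]|).

Definition start (home : 'I_n) (m : nat) : cfg :=
  Config (fun _ => Some (AgentState home (init_memory A) false))
         (fun v => if v == home then m else 0).

(* The configuration at the beginning of round t, before the adversary's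
   decision for that round takes effect. *)
Fixpoint run (home vb : 'I_n) (m : nat) (adv : adversary) (arb : nat -> 'S_k)
    (t : nat) : cfg :=
  if t is u.+1 then
    team_step (arb u) (strike vb adv u (run home vb m adv arb u))
  else start home m.

End Round.

(* PerpExploration-BBH on the ring of size n by k agents that are initially
   co-located, together with m pebbles, at a safe node.  For n = 3 two agents
   suffice: one stays at home while the other alternates between the two
   neighbours of home, so that its failure to return locates vb. *)
Definition solves_PerpExploration_BBH (n k c m : nat) (A : algorithm k c) : Prop :=
  forall (ids : 'I_k -> agent_id k c) (home vb : 'I_n)
         (adv : adversary) (arb : nat -> 'S_k),
    injective ids -> home != vb -> fair_arbitration arb ->
    forall v : 'I_n, v != vb ->
    forall T : nat, exists t : nat, T <= t /\
      exists i : 'I_k, at_node (run A ids home vb m adv arb t) i v.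

(* Main.v *)
(* Two agents fail.  Suppose that, as long as the black hole is inactive, agent i
   moves from j to j', both different from home.  Compare a black hole at j, active
   from the round of this move on, with one at j', active from the next round on,
   both of which leave the pebbles alone.  In both worlds i dies, and the other agent
   cannot tell them apart without visiting j.  It would die at j in the first world,
   hence never visits j; so it does not visit j in the second one either, although j
   is safe there.  So no agent ever reaches a node at distance two from home.

   Three agents succeed.  The keeper stays at home with one pebble while the ferry
   and the lead go round the ring with the other.  When they are together at node j
   (counted from home), the pebble is on j - 1; the ferry fetches it from j - 1,
   drops it at j and joins the lead, which waits at j + 1.
   - If both die, they die at the same node, the one after the pebble: the keeper,
     seeing nobody come home, walks until it finds the pebble.
   - If the lead dies, or if the pebble on j - 1 has been erased, the ferry knows
     where the black hole is.
   - If the ferry dies, the lead knows that the black hole is at j - 1 or j.  It goes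
     home through the other nodes and lets the keeper know j by the date of its next
     departure.  From then on it visits j - 1 from one side and j from the other;
     the trip from which it fails to return tells the keeper where the black hole is.
   A single agent that knows the position of the black hole explores the rest. *)

Require Import Defs.
From mathcomp Require Import zify.

Set Implicit Arguments.
Unset Strict Implicit.
Unset Printing Implicit Defensive.

(** * Two agents *)

(** A concrete fair schedule for the lower bound: identity and reversal order every pair of distinct
    agents in opposite ways. *)
Definition alternating k (t : nat) : 'S_k :=
  if odd t then perm (@rev_ord_inj k) else 1%g.

Lemma alternating_fair k : fair_arbitration (@alternating k).
Proof.
move=> i j neq_ij T; have [lt_ij|le_ji] := ltnP i j.
  exists T.*2; split; first by lia.
  by rewrite /alternating odd_double !perm1.
exists T.*2.+1; split; first by lia.
rewrite /alternating /= odd_double !permE /=.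
move: neq_ij (ltn_ord i) (ltn_ord j); rewrite -val_eqE /=; lia.
Qed.

Lemma at_node_cases n k M (cf : config n k M) i v :
  at_node cf i v ->
  exists2 s, agents cf i = Some s & position s = v.
Proof. by rewrite /at_node; case: (agents cf i) => // s /eqP; exists s. Qed.

(** * Persistence of destruction *)

Section Dead.

Variables (n k c m : nat) (A : algorithm k c) (ids : 'I_k -> agent_id k c).
Variables (home vb : 'I_n) (adv : adversary) (arb : nat -> 'S_k).
Local Notation runA := (run A ids home vb m adv arb).

Lemma dead_stays_dead i t t' :
  t <= t' -> agents (runA t) i = None -> agents (runA t') i = None.
Proof.
move=> /subnK <-; elim: (t' - t) => [|d IHd] //= /IHd ->.
by case: ifP.
Qed.

Lemma struck_dead i t : active adv t -> at_node (runA t) i vb ->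
  agents (runA t.+1) i = None.
Proof. by move=> /= -> ->. Qed.

Lemma dead_not_at i t v : agents (runA t) i = None -> at_node (runA t) i v = false.
Proof. by rewrite /at_node => ->. Qed.

End Dead.

(** * One round as perceived by the surviving agent *)

Section Step.
Variables (n k c : nat) (A : algorithm k c) (ids : 'I_k -> agent_id k c).
Variables (p : 'S_k) (i b : 'I_k).
Hypothesis only_b : forall j, j != i -> j = b.
Implicit Types cf : config n k (memory A).

(** Two worlds that [b] cannot tell apart as long as it stays away from [v0], the only node whose
    pebbles may differ. *)
Definition alike (v0 : 'I_n) cf cf' (s : agent_state n (memory A)) :=
  [/\ agents cf b = Some s, agents cf' b = Some s, position s != v0 &
      forall v, v != v0 -> pebbles cf v = pebbles cf' v].

(** The snapshot of [b] concerns only its own node, where [i] is absent and the pebbles agree. Hence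
    [b] acts identically in both worlds, and away from [v0] nobody else touches the pebbles. *)
Lemma alike_step v0 cf cf' s : b != i ->
  (forall v, v != v0 -> ~~ at_node cf i v) ->
  (forall v, v != v0 -> ~~ at_node cf' i v) ->
  alike v0 cf cf' s ->
  agents (team_step ids p cf) b = agents (team_step ids p cf') b /\
  forall v, v != v0 ->
    pebbles (team_step ids p cf) v = pebbles (team_step ids p cf') v.
Proof.
move=> neq_bi i_v0 i_v0' [cfb cf'b bv0 eq_p].
have eq_at v : v != v0 -> forall j, at_node cf j v = at_node cf' j v.
  move=> vv0 j; have [->|/only_b ->] := eqVneq j i.
    by rewrite (negbTE (i_v0 v vv0)) (negbTE (i_v0' v vv0)).
  by rewrite /at_node cfb cf'b.
have eq_view : view_of ids cf b s = view_of ids cf' b s.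
  rewrite /view_of eq_p //; congr View; apply/setP => a.
  by apply/imsetP/imsetP=> -[j jP ->]; exists j => //;
    move: jP; rewrite !inE eq_at.
have away cf0 : (forall v, v != v0 -> ~~ at_node cf0 i v) -> forall v, v != v0 ->
    (requests ids cf0 i v = false) * (drops ids cf0 i v = false).
  move=> h v /h; rewrite /requests /drops /at_node.
  by case: (agents cf0 i) => // s0 /negbTE ->.
have eq_op : op_of ids cf b s = op_of ids cf' b s by rewrite /op_of eq_view.
have eq_req v : v != v0 -> requests ids cf ^~ v =1 requests ids cf' ^~ v.
  move=> vv0 j; have [->|/only_b ->] := eqVneq j i; first by rewrite !away.
  by rewrite /requests cfb cf'b eq_op.
have eq_drop v : v != v0 -> drops ids cf ^~ v =1 drops ids cf' ^~ v.
  move=> vv0 j; have [->|/only_b ->] := eqVneq j i; first by rewrite !away.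
  by rewrite /drops cfb cf'b eq_op.
have eq_pick v : v != v0 -> picks ids p cf ^~ v =1 picks ids p cf' ^~ v.
  move=> vv0 j; rewrite /picks eq_req // eq_p //; congr (_ && (_ < _)).
  by apply: eq_card => j'; rewrite !inE eq_req.
split=> [|v vv0] /=.
  by rewrite cfb cf'b /= /agent_step eq_view eq_pick // eq_drop.
rewrite eq_p //; congr (_ - _ + _); apply: eq_card => j; rewrite !inE.
  exact: eq_pick.
exact: eq_drop.
Qed.
End Step.

(** * Indistinguishable worlds for two agents *)

Section TwoAgents.

Variables (n k c m : nat) (A : algorithm k c) (ids : 'I_k -> agent_id k c).
Variables (home : 'I_n) (arb : nat -> 'S_k).
Hypothesis lt_k3 : k < 3.
Hypothesis ids_inj : injective ids.
Hypothesis arb_fair : fair_arbitration arb.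
Hypothesis solved : @solves_PerpExploration_BBH n k c m A.

Definition active_from t := Adversary (fun s => t <= s) (fun=> false).
Definition inert := Adversary (fun=> false) (fun=> false).

Local Notation run_from vb t := (run A ids home vb m (active_from t) arb).
Local Notation free_run vb := (run A ids home vb m inert arb).

(** Before its activation the hole has no effect, so its position is irrelevant as well. *)
Lemma run_fromE vb vb' t s : s <= t -> run_from vb t s = free_run vb' s.
Proof.
elim: s => //= s IHs lt_st; rewrite IHs ?(ltnW lt_st) //; congr team_step.
by rewrite /strike /= leqNgt lt_st.
Qed.

(** [i] dies in round [t], yet [home] must still be visited after every later round. So some other
    agent outlives round [s], hence is not on the active hole then; with fewer than three agents it
    is the same one for all [s]. *)
Lemma survivor vb t i : home != vb -> at_node (run_from vb t t) i vb ->
  exists2 b, b != i & forall s, t <= s ->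
    exists2 st, agents (run_from vb t s) b = Some st & position st != vb.
Proof.
move=> hvb i_vb.
have alive s : t <= s -> exists2 b, b != i &
    exists2 st, agents (run_from vb t s) b = Some st & position st != vb.
  move=> le_ts.
  have [T [leT [b b_home]]] := solved (active_from t) ids_inj hvb arb_fair hvb s.+1.
  exists b.
    apply: contraTneq b_home => ->; rewrite dead_not_at //.
    apply: (@dead_stays_dead _ _ _ _ _ _ _ _ _ _ i t.+1); first by lia.
    by apply: struck_dead; rewrite /= ?leqnn.
  have: agents (run_from vb t s.+1) b <> None.
    move=> b_dead; move: b_home; rewrite dead_not_at //.
    exact: dead_stays_dead b_dead.
  rewrite /= le_ts /= /at_node.
  by case: (agents _ b) => // st; have [|] := eqVneq (position st) vb; last exists st.
have [b neq_bi _] := alive t (leqnn t); exists b => // s /alive [b' neq_b'i b'P].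
suff -> : b = b' by [].
apply: val_inj; move: neq_bi neq_b'i; rewrite -!val_eqE /=.
have := ltn_ord b; have := ltn_ord b'; have := ltn_ord i; lia.
Qed.

Lemma sole_companion (b i j : 'I_k) : b != i -> j != i -> j = b.
Proof.
move=> neq_bi neq_ji; apply: val_inj; move: neq_bi neq_ji; rewrite -!val_eqE /=.
by have := ltn_ord b; have := ltn_ord j; have := ltn_ord i; lia.
Qed.

Lemma no_unsafe_move vb t i (j j' : 'I_n) : j != home -> j' != home -> j != j' ->
  at_node (free_run vb t) i j -> at_node (free_run vb t.+1) i j' -> False.
Proof.
move=> hj hj' neq_jj' i_j i_j'.
have [hj1 hj'1] : home != j /\ home != j' by rewrite ![home == _]eq_sym.
have i_j1 : at_node (run_from j t t) i j by rewrite (run_fromE _ vb).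
have i_j2 : at_node (run_from j' t.+1 t.+1) i j' by rewrite (run_fromE _ vb).
have [b neq_bi alive1] := survivor hj1 i_j1.
have [b2 neq_b2i alive2] := survivor hj'1 i_j2.
have only_b := sole_companion neq_bi; rewrite (only_b _ neq_b2i) in alive2 => {b2 neq_b2i}.
have [s2 s2E] : exists s, agents (free_run vb t) b = Some s /\ position s != j.
  by have [s] := alive1 t (leqnn t); rewrite (run_fromE _ vb) // => ? ?; exists s.
pose R1 := run_from j t; pose R2 := run_from j' t.+1.
have keep w t0 u (cf : config n k (memory A)) v :
    pebbles (strike w (active_from t0) u cf) v = pebbles cf v.
  by rewrite /= andbF.
have idle w (cf : config n k (memory A)) a :
    agents (strike w (active_from t.+1) t cf) a = agents cf a.
  by rewrite /= ltnn.
have step1 u s : t <= u -> agents (R1 u) b = Some s ->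
    agents (strike j (active_from t) u (R1 u)) b = Some s.
  move=> le_tu bu; have [s' ] := alive1 _ le_tu.
  by rewrite /R1 in bu; rewrite bu => -[<-] /negbTE sj; rewrite /= /at_node bu sj andbF.
have step2 u s : t < u -> agents (R2 u) b = Some s ->
    agents (strike j' (active_from t.+1) u (R2 u)) b = Some s.
  move=> le_tu bu; have [s' ] := alive2 _ le_tu.
  by rewrite /R2 in bu; rewrite bu => -[<-] /negbTE sj; rewrite /= /at_node bu sj andbF.
have dead1 u v : t <= u -> at_node (strike j (active_from t) u (R1 u)) i v = false.
  rewrite leq_eqVlt => /predU1P[<-|lt_tu].
    by rewrite /at_node /= leqnn i_j1.
  rewrite /at_node /= (@dead_stays_dead _ _ _ _ _ _ _ _ _ _ i t.+1 u) //.
    by rewrite if_same.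
  by apply: struck_dead => //=.
have dead2 u v : t < u -> at_node (strike j' (active_from t.+1) u (R2 u)) i v = false.
  rewrite leq_eqVlt => /predU1P[<-|lt_tu].
    by rewrite /at_node /= leqnn i_j2.
  rewrite /at_node /= (@dead_stays_dead _ _ _ _ _ _ _ _ _ _ i t.+2 u) //.
    by rewrite if_same.
  by apply: struck_dead => //=.
(* The comparison starts at round [t + 1]: by then [i] is dead in the first world, and in the second
   it is on [j'], about to be destroyed. *)
have same d : agents (R1 (t.+1 + d)) b = agents (R2 (t.+1 + d)) b /\
    forall v, v != j -> pebbles (R1 (t.+1 + d)) v = pebbles (R2 (t.+1 + d)) v.
  elim: d => [|d [eq_b eq_p]]; last first.
    have le_tu : t < t.+1 + d by rewrite leq_addr.
    have [s bs sj] := alive1 _ (ltnW le_tu).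
    rewrite addnS; apply: (@alike_step _ _ _ _ _ (arb (t.+1 + d)) _ _ only_b j
      (strike j (active_from t) (t.+1 + d) (R1 (t.+1 + d)))
      (strike j' (active_from t.+1) (t.+1 + d) (R2 (t.+1 + d))) s neq_bi) => [v _|v _|].
    - by rewrite dead1 // ltnW.
    - by rewrite dead2.
    split=> //; first exact/step1/bs/ltnW.
      by apply: step2 => //; rewrite -eq_b.
    by move=> v vj; rewrite !keep; apply: eq_p.
  have [bs sj] := s2E.
  rewrite addn0; apply: (@alike_step _ _ _ _ _ (arb t) _ _ only_b j
    (strike j (active_from t) t (R1 t)) (strike j' (active_from t.+1) t (R2 t))
    s2 neq_bi) => [v _|v vj|].
  - by rewrite dead1.
  (* In round [t] of the second world [i] is still alive at [j] and may handle pebbles there, which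
     is why [j] is exempted. *)
  - have i_j3 : at_node (R2 t) i j by rewrite /R2 (run_fromE _ vb).
    rewrite /at_node idle; have [s -> ps] := at_node_cases i_j3.
    by rewrite ps eq_sym.
  split=> //; first by apply: step1; rewrite // /R1 (run_fromE _ vb).
    by rewrite idle /R2 (run_fromE _ vb).
  by move=> v _; rewrite !keep /R1 /R2 !(run_fromE _ vb).
(* In the second world [j] is safe and must be visited after round [t]. Neither agent can do it: [i]
   is on [j'] and then dead, and [b] avoids [j] as in the first world. *)
have [T [leT [a a_j]]] := solved (active_from t.+1) ids_inj hj'1 arb_fair neq_jj' t.+1.
have [ai|/only_b ab] := eqVneq a i.
  move: leT a_j; rewrite ai leq_eqVlt => /predU1P[<-|lt_T].
    have [s] := at_node_cases i_j2; rewrite /at_node => -> ->.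
    by rewrite eq_sym (negbTE neq_jj').
  rewrite dead_not_at // (@dead_stays_dead _ _ _ _ _ _ _ _ _ _ i t.+2) //.
  by apply: struck_dead => /=.
have [s bs sj] := alive1 _ (ltnW leT).
have [+ _] := same (T - t.+1); rewrite subnKC // /R1 bs => bs2.
by move: a_j; rewrite ab /at_node -/R2 -bs2 (negbTE sj).
Qed.

End TwoAgents.

Lemma two_agents_fail k c m (A : algorithm k c) n :
  0 < c -> k < 3 -> 4 <= n -> ~ @solves_PerpExploration_BBH n k c m A.
Proof.
move=> c_gt0 lt_k3 le_4n solved.
have le_ids : k <= (k ^ c).+1.
  case: (k) => // k'; rewrite (leq_trans _ (leqnSn _)) //.
  by rewrite -{1}[k'.+1]expn1 leq_pexp2l.
pose ids := widen_ord le_ids.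
have ids_inj : injective ids by move=> i j /(congr1 val) /= /val_inj.
have n_gt0 : 0 < n by lia.
pose home : 'I_n := Ordinal n_gt0.
pose far := ordS (ordS home); pose vb := ordS home.
have [home_far home_vb far_vb] : [/\ home != far, home != vb & far != vb].
  by rewrite -!val_eqE /= !modn_small; do ?split; lia.
have free := no_unsafe_move lt_k3 ids_inj (@alternating_fair k) solved (home := home) (vb := vb).
have never t i : ~~ at_node (run A ids home vb m inert (@alternating k) t) i far.
  elim: t => [|t IHt].
    exact: home_far.
  apply/negP => i_far; case: (@at_node_cases _ _ _ _ _ _ i_far) => s.
  rewrite /=; case Ei: (agents _ i) => [s0|] //= [<-] /= s_far.
  have i_s0 : at_node (run A ids home vb m inert (@alternating k) t) i (position s0).
    by rewrite /at_node Ei eqxx.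
  have s0_far : position s0 != far by apply: contraNneq IHt => <-.
  apply: (free t i (position s0) far) => //; last by rewrite eq_sym.
  (* A first arrival at [far] from another node than [home] would be an unsafe move; from [home] it
     is impossible, since for n >= 4 [far] is two steps away on both sides. *)
  apply/eqP => s0_home; move: s_far; rewrite s0_home => /(congr1 val).
  by case: (_.2) => /=; rewrite ?modn_small; lia.
have [T [_ [i]]] := solved ids home vb inert _ ids_inj home_vb (@alternating_fair k) far far_vb 0.
by rewrite (negbTE (never _ _)).
Qed.

(** * The algorithm for three agents *)

(* [Watch t], [Ferry t] and [Lead t] are the keeper, the ferry and the lead at round
   t of a tour, which takes 3n - 2 rounds: ferry and lead are together at node j > 0
   at t = 3j - 2.
   [Search z]: the keeper, at node z, looks for the pebble.
   [Walk a b s]: date s, modulo 4n - 2, of a cycle of trips from home: wait for 2n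
   rounds, go right to a and back, then left to b and back.
   [Listen t]: the keeper has been waiting for t rounds for the departure of the lead.
   [Guard j s]: the keeper knows that the lead is in [Walk (j - 1) j s]. *)
Inductive phase :=
  | Watch of nat
  | Ferry of nat
  | Lead of nat
  | Search of nat
  | Listen of nat
  | Guard of nat & nat
  | Walk of nat & nat & nat.

Definition tick p t := if t.+1 == p then 0 else t.+1.

Definition walk_dir n a b s :=
  if s < 2 * n then Stay
  else if s < 2 * n + a then GoRight
  else if s < 2 * n + 2 * a + (n - b) then GoLeft
  else if s < 2 * n + 2 * a + 2 * (n - b) then GoRight
  else Stay.

(* [first] and [last]: all the IDs seen are larger (resp. smaller) than that of the
   agent, which distributes the roles when the three agents are at home.  [others]
   counts the agents seen, [pebs] the pebbles, [h] tells whether a pebble is held. *)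
Definition program n (first last : bool) (others pebs : nat) (h : bool)
    (m : phase) : phase * direction :=
  let depart :=
    if first then (Watch 1, Stay)
    else if last then (Lead 1, GoRight)
    else (Ferry 1, GoRight) in
  let next t := tick (3 * n - 2) t in
  match m with
  | Watch t =>
      if t != 0 then (Watch (next t), Stay)
      else if others == 2 then depart
      else if others == 1 then (Listen 1, Stay)
      else (Search 0, Stay)
  | Ferry t =>
      let j := (t + 2) %/ 3 in
      if t == 0 then depart
      else if t %% 3 == 1 then
        if others == 0 then (Walk (j - 1) (j + 1) (2 * n + j - 1), GoLeft)
        else (Ferry (next t), GoLeft)
      else if (t %% 3 == 2) && ~~ h then
        (Walk (j - 2) j (2 * n + j - 2), GoLeft)
      else (Ferry (next t), GoRight)
  | Lead t =>
      let j := (t + 2) %/ 3 - 1 in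
      if t == 0 then
        if others == 2 then depart else (Walk (n - 2) (n - 1) 0, Stay)
      else if t %% 3 == 1 then
        if others == 0 then (Walk (j - 1) j (3 * n + j - 1), Stay)
        else (Lead (next t), GoRight)
      else (Lead (next t), Stay)
  | Search z =>
      (* one pebble always stays at home *)
      if (z == 0) < pebs then (Walk z (z + 2) (2 * n + z), Stay)
      else (Search z.+1, GoRight)
  | Listen t =>
      if others == 0 then (Guard ((t - 4) %/ 2) (2 * n + 2), Stay)
      else (Listen t.+1, Stay)
  | Guard j s =>
      if (others == 0) && (s == 2 * n + 2 * (j - 1)) then
        (Walk (j - 2) j 0, Stay)
      else if (others == 0) && (s == 0) then (Walk (j - 1) (j + 1) 0, Stay)
      else (Guard j (tick (4 * n - 2) s), Stay)
  | Walk a b s => (Walk a b (tick (4 * n - 2) s), walk_dir n a b s)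
  end.

(** Only the ferry handles pebbles: it picks up at j - 1 at date 3j - 1 and drops at j at date 3j.
    At the last such date, 3n - 3, it keeps the pebble, to drop it at home at date 0. *)
Definition phase_op n (m : phase) : pebble_op :=
  if m is Ferry t then
    if t %% 3 == 2 then PickUp
    else if (t %% 3 == 0) && (t != 3 * n - 3) then Drop
    else NoOp
  else NoOp.

(** * Coding the phases in a finite memory *)

Section Encoding.

Variable N : nat.

Definition phase_code : Type := ('I_8 * 'I_N.+1 * 'I_N.+1 * 'I_N.+1)%type.

Definition encode (m : phase) : phase_code :=
  match m with
  | Watch t => (inord 0, inord t, ord0, ord0)
  | Ferry t => (inord 1, inord t, ord0, ord0)
  | Lead t => (inord 2, inord t, ord0, ord0)
  | Search z => (inord 3, inord z, ord0, ord0)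
  | Listen t => (inord 4, inord t, ord0, ord0)
  | Guard j s => (inord 5, inord j, inord s, ord0)
  | Walk a b s => (inord 6, inord a, inord b, inord s)
  end.

Definition decode (e : phase_code) : phase :=
  let: (g, x, y, z) := e in
  match (g : nat) with
  | 0 => Watch x
  | 1 => Ferry x
  | 2 => Lead x
  | 3 => Search x
  | 4 => Listen x
  | 5 => Guard x y
  | _ => Walk x y z
  end.

(** [inord] is faithful only up to the bound [N], so [encodeK] needs all counters to respect it; the
    correctness proof checks this with [N] equal to 4n. *)
Definition fits (m : phase) : bool :=
  match m with
  | Watch t | Ferry t | Lead t | Search t | Listen t => t <= N
  | Guard j s => (j <= N) && (s <= N)
  | Walk a b s => [&& a <= N, b <= N & s <= N]
  end.

Lemma encodeK m : fits m -> decode (encode m) = m.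
Proof.
case: m => [t|t|t|t|t|j s|a b s] /= le_N; rewrite !inordK //; case/andP: le_N => //.
  by move=> _ /andP[].
by move=> _ /andP[].
Qed.

End Encoding.

Definition ring_algorithm k c n : algorithm k c :=
  Algorithm (encode (4 * n) (Watch 0))
    (fun _ e _ => phase_op n (decode e))
    (fun id e S h =>
       let r := program n [forall i in ids_seen S, id < i]
                          [forall i in ids_seen S, i < id]
                          #|ids_seen S| (pebbles_seen S) h (decode e) in
       (encode (4 * n) r.1, r.2)).

Lemma ring_algorithm_log_memory k c : log_memory (ring_algorithm k c).
Proof.
(* Three bits for the tag and 3 + u bits for each of three counters, with u = [up_log 2 n], make 12
   + 3u bits, at most 15u since u > 0. *)
exists 15 => n n_gt1 /=.
have /andP[_ le_n] := up_log_bounds (isT : 1 < 2) n_gt1.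
have u_gt0 : 0 < up_log 2 n by rewrite up_log_gt0.
set u := up_log 2 n in le_n u_gt0 *.
rewrite !card_prod !card_ord.
have le_N : (4 * n).+1 <= 2 ^ (3 + u) by rewrite expnD; lia.
have -> : 8 = 2 ^ 3 by [].
apply: (@leq_trans (2 ^ (3 + (3 + u) + (3 + u) + (3 + u)))).
  by rewrite !(expnD 2 _ (3 + u)) !leq_mul.
by rewrite leq_pexp2l //; lia.
Qed.

(** Position at date [s] of a walk, in coordinates where home is both 0 and n: the right trip runs
    from 0 to [a], the left trip from n to [b]. The trips and the wait of 2n rounds take at most 4n
    - 2 rounds because a < b. *)
Definition walk_pos n a b s :=
  if s < 2 * n then 0
  else if s < 2 * n + a then s - 2 * n
  else if s <= 2 * n + 2 * a then 2 * n + 2 * a - s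
  else if s <= 2 * n + 2 * a + (n - b) then 3 * n + 2 * a - s
  else if s <= 2 * n + 2 * a + 2 * (n - b) then b + (s - (3 * n + 2 * a - b))
  else n.

Lemma walk_pos_home n a b s : s <= 2 * n -> walk_pos n a b s = 0.
Proof. by rewrite /walk_pos => le_s; do ?case: ifP; lia. Qed.

Lemma walk_pos_visits n a b v : 2 < n -> a < b <= n -> v < n -> v <= a \/ b <= v ->
  exists2 s, s < 4 * n - 2 & walk_pos n a b s = v.
Proof.
move=> n_gt2 le_abn lt_vn [le_va|le_bv].
  by exists (2 * n + v); rewrite /walk_pos; do ?case: ifP; lia.
by exists (3 * n + 2 * a - v); rewrite /walk_pos; do ?case: ifP; lia.
Qed.

(** Liveness for a periodic behaviour: [Q s t] says that round [t] has date [s] in the cycle, and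
    [D] is a goal that may also be met by leaving the cycle. One induction waits for round [T], the
    other for the next occurrence of date [g]. *)
Lemma cycle_reaches p g T (Q : nat -> nat -> Prop) (D : nat -> Prop) : g < p ->
  (forall t, D t.+1 -> D t) -> (forall t, T <= t -> Q g t -> D t) ->
  (forall s t, s < p -> Q s t -> Q (tick p s) t.+1 \/ D t.+1) ->
  forall s t, s < p -> Q s t -> D t.
Proof.
move=> lt_gp D_prev D_g Q_step.
have lt_tick s : s < p -> tick p s < p by rewrite /tick; case: ifP; lia.
suff reach d : forall s t, s < p -> T <= t ->
    (if s <= g then g - s else p - s + g) = d -> Q s t -> D t.
  suff wait e : forall s t, s < p -> T - t = e -> Q s t -> D t.
    by move=> s t lt_sp; apply: wait lt_sp erefl.
  elim: e => [|e IHe] s t lt_sp te Qst; first by apply: reach Qst => //; lia.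
  apply: D_prev; case: (Q_step _ _ lt_sp Qst) => // Qs'.
  by apply: IHe Qs'; [exact: lt_tick|lia].
elim: d => [|d IHd] s t lt_sp le_Tt sd Qst.
  have sg : s = g by move: sd; case: ifP; lia.
  by apply: D_g; rewrite // -sg.
apply: D_prev; case: (Q_step _ _ lt_sp Qst) => // Qs'.
apply: IHd Qs'; [exact: lt_tick|by lia|].
by move: sd; rewrite /tick; do 3?case: ifP; lia.
Qed.

(** The analogue for a transient behaviour, which ends at date [p]. *)
Lemma line_reaches p (Q : nat -> nat -> Prop) (D : nat -> Prop) :
  (forall t, D t.+1 -> D t) -> (forall t, Q p t -> D t) ->
  (forall s t, s < p -> Q s t -> Q s.+1 t.+1 \/ D t.+1) ->
  forall s t, s <= p -> Q s t -> D t.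
Proof.
move=> D_prev D_p Q_step.
suff reach d : forall s t, s <= p -> p - s = d -> Q s t -> D t.
  by move=> s t le_sp; apply: reach le_sp erefl.
elim: d => [|d IHd] s t le_sp sd Qst.
  have sp : s = p by lia.
  by apply: D_p; rewrite -sp.
apply: D_prev; have [||Qs'|//] := Q_step s t => //; first by lia.
by apply: IHd Qs'; lia.
Qed.

(** * Coordinates on the ring *)

Section Ring.

Variables (n : nat) (home : 'I_n).

(* Nodes are counted from home, which is both [nd 0] and [nd n]. *)
Definition nd k : 'I_n := iter k (@ordS n) home.

Lemma nd_val k : nd k = (home + k) %% n :> nat.
Proof.
elim: k => [|k IHk] /=; first by rewrite addn0 modn_small.
by rewrite IHk -addn1 modnDml addn1 addnS.
Qed.

Lemma ndn : nd n = nd 0.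
Proof. by apply: val_inj; rewrite /= nd_val modnDr modn_small. Qed.

Lemma nd_eq q r : q <= n -> r <= n ->
  (nd q == nd r) = [|| q == r, (q == 0) && (r == n) | (q == n) && (r == 0)].
Proof.
have small q' r' : q' < n -> r' < n -> (nd q' == nd r') = (q' == r').
  move=> lt_q lt_r; rewrite -val_eqE /= !nd_val eqn_modDl !modn_small //.
have n_gt0 : 0 < n by case: (n) home => // -[].
rewrite leq_eqVlt => /predU1P[->|lt_q]; rewrite leq_eqVlt => /predU1P[->|lt_r].
- by rewrite !eqxx.
- by rewrite ndn small // !eqxx /=; lia.
- by rewrite ndn small // !eqxx /=; lia.
- by rewrite small //; lia.
Qed.

Lemma nd_surj v : exists2 k, k < n & v = nd k.
Proof.
have n_gt0 : 0 < n by case: (n) home => // -[].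
exists ((v + n - home) %% n); first by rewrite ltn_mod.
apply: val_inj; rewrite /= nd_val modnDmr subnKC ?modnDr ?modn_small //.
by have := ltn_ord home; lia.
Qed.

Lemma nd_left k : neighbour (nd k.+1) GoLeft = nd k.
Proof. exact: ordSK. Qed.

Lemma nd_left0 : neighbour (nd 0) GoLeft = nd n.-1.
Proof.
by rewrite -ndn -[in nd n](@prednK n) ?nd_left //; case: (n) home => // -[].
Qed.

Lemma nd_left_pos k : 0 < k -> neighbour (nd k) GoLeft = nd k.-1.
Proof. by case: k => // k _; apply: nd_left. Qed.

(** The moves realize [walk_pos], including where the coordinate of home jumps between 0 and n: at
    the start of the left trip and at the end of the period. *)
Lemma walk_step a b s : a < b <= n -> s < 4 * n - 2 ->
  neighbour (nd (walk_pos n a b s)) (walk_dir n a b s)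
  = nd (walk_pos n a b (tick (4 * n - 2) s)).
Proof.
move=> le_abn lt_s.
have n_gt0 : 0 < n by case: (n) home => // -[].
have tickE : tick (4 * n - 2) s = if s.+1 == 4 * n - 2 then 0 else s.+1 by [].
rewrite tickE /walk_dir.
have stay q r : q <= n -> r <= n -> [|| q == r, (q == 0) && (r == n) | (q == n) && (r == 0)] ->
    neighbour (nd q) Stay = nd r.
  by move=> le_q le_r qr; apply/eqP; rewrite nd_eq.
have right q r : q < n -> r <= n -> (q.+1 == r) || (q.+1 == n) && (r == 0) ->
    neighbour (nd q) GoRight = nd r.
  by move=> lt_q le_r qr; apply/eqP; rewrite [_ == _](@nd_eq q.+1 r); lia.
have left q r : q <= n -> r <= n -> (q == r.+1) || (q == 0) && (r == n.-1) ->
    neighbour (nd q) GoLeft = nd r.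
  move=> le_q le_r /orP[/eqP->|/andP[/eqP-> /eqP->]]; first exact: nd_left.
  exact: nd_left0.
have [lt_s1|le_s1] := ltnP s (2 * n).
  by apply: stay; rewrite /walk_pos; do ?case: ifP; lia.
have [lt_s2|le_s2] := ltnP s (2 * n + a).
  by apply: right; rewrite /walk_pos; do ?case: ifP; lia.
have [lt_s3|le_s3] := ltnP s (2 * n + 2 * a + (n - b)).
  by apply: left; rewrite /walk_pos; do ?case: ifP; lia.
have [lt_s4|le_s4] := ltnP s (2 * n + 2 * a + 2 * (n - b)).
  by apply: right; rewrite /walk_pos; do ?case: ifP; lia.
by apply: stay; rewrite /walk_pos; do ?case: ifP; lia.
Qed.
End Ring.

(** * Correctness *)

Lemma strike_survivor n k M (vb : 'I_n) adv u (cf : config n k M) i s :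
  agents cf i = Some s -> active adv u && (position s == vb) = false ->
  agents (strike vb adv u cf) i = Some s.
Proof. by rewrite /= /at_node => -> ->. Qed.

Lemma strike_victim n k M (vb : 'I_n) adv u (cf : config n k M) i s :
  agents cf i = Some s -> active adv u -> position s = vb ->
  agents (strike vb adv u cf) i = None.
Proof. by rewrite /= /at_node => -> -> ->; rewrite eqxx. Qed.

(** * One round of the three agents *)

Section Team.

Variables (n c : nat) (ids : 'I_3 -> agent_id 3 c) (home : 'I_n).
Hypothesis n_gt2 : 2 < n.
Hypothesis ids_inj : injective ids.

Local Notation A := (ring_algorithm 3 c n).
Local Notation nd := (nd home).
Local Notation wpos := (walk_pos n).
Local Notation L := (4 * n - 2).
Local Notation P := (3 * n - 2).
Implicit Types (cf : config n 3 (memory A)) (p : 'S_3) (i : 'I_3).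

Definition St k m cr : agent_state n (memory A) :=
  AgentState (nd k) (encode (4 * n) m : memory A) cr.

(** Forgets whether a pebble is carried, which matters only for the ferry on tour. *)
Definition here cf i k m := exists cr, agents cf i = Some (St k m cr).

Lemma mem_trio i j l h : uniq [:: i; j; l] -> h \in [:: i; j; l].
Proof.
rewrite /= !inE negb_or andbT -!val_eqE /=.
by move: (ltn_ord h) (ltn_ord i) (ltn_ord j) (ltn_ord l); lia.
Qed.

Lemma card_ids_seen cf i j l s : uniq [:: i; j; l] ->
  #|ids_seen (view_of ids cf i s)|
  = at_node cf j (position s) + at_node cf l (position s).
Proof.
move=> ijl; have uniq_ijl := ijl; rewrite /view_of /= card_imset //.
rewrite /= !inE negb_or andbT in uniq_ijl *.
have all_ijl h : [|| h == i, h == j | h == l].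
  by have := mem_trio h ijl; rewrite !inE.
have [ij il jl] : [/\ i != j, i != l & j != l] by split; lia.
rewrite -sum1_card big_mkcond (bigD1 i) //= (bigD1 j) 1?eq_sym //= (bigD1 l) /=; last first.
  by rewrite eq_sym il eq_sym.
rewrite big1 => [|h]; last by have := all_ijl h; case: eqP; case: eqP; case: eqP.
rewrite !inE eqxx (eq_sym j) (eq_sym l) ij il /=.
by case: ifP; case: ifP.
Qed.

Lemma team_stepE p cf i k m cr : agents cf i = Some (St k m cr) -> fits (4 * n) m ->
  let S := view_of ids cf i (St k m cr) in
  let h := picks ids p cf i (nd k) || (cr && ~~ drops ids cf i (nd k)) in
  let r := program n [forall z in ids_seen S, ids i < z]
             [forall z in ids_seen S, z < ids i] #|ids_seen S|
             (pebbles cf (nd k)) h m in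
  agents (team_step ids p cf) i
  = Some (AgentState (neighbour (nd k) r.2) (encode (4 * n) r.1 : memory A) h).
Proof. by move=> cfi fit_m; rewrite /= cfi /= /agent_step /= encodeK. Qed.


(** For phases whose reaction depends only on the numbers of agents and pebbles present: neither the
    order of the IDs nor the success of a pick-up has to be known. *)
Lemma here_next p cf i j l k q m m' d : uniq [:: i; j; l] ->
  here cf i k m -> fits (4 * n) m ->
  (forall fst lst h, program n fst lst
     (at_node cf j (nd k) + at_node cf l (nd k)) (pebbles cf (nd k)) h m = (m', d)) ->
  neighbour (nd k) d = nd q ->
  here (team_step ids p cf) i q m'.
Proof.
move=> ijl [cr cfi] fit_m prog_m kq; rewrite /here (team_stepE _ cfi fit_m).
rewrite (card_ids_seen _ _ ijl) prog_m /= kq.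
by eexists.
Qed.

Lemma walk_next p cf i a b s : a < b <= n -> s < L ->
  here cf i (wpos a b s) (Walk a b s) ->
  here (team_step ids p cf) i (wpos a b (tick L s)) (Walk a b (tick L s)).
Proof.
move=> le_abn lt_s [cr cfi]; rewrite /here (team_stepE _ cfi) /=; last by lia.
by rewrite walk_step //; eexists.
Qed.

Lemma at_gone cf j v : agents cf j = None -> at_node cf j v = false.
Proof. by rewrite /at_node => ->. Qed.

Lemma at_here cf j q m v : here cf j q m -> at_node cf j v = (nd q == v).
Proof. by rewrite /at_node => -[cr ->]. Qed.

Lemma step_gone p cf i : agents cf i = None -> agents (team_step ids p cf) i = None.
Proof. by rewrite /= => ->. Qed.

Lemma strike_gone vb adv u cf i :
  agents cf i = None -> agents (strike vb adv u cf) i = None.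
Proof. by rewrite /= => ->; case: ifP. Qed.

Definition idle cf i :=
  forall s, agents cf i = Some s -> op_of ids cf i s = NoOp.

Lemma op_ofE cf i k m cr : fits (4 * n) m -> op_of ids cf i (St k m cr) = phase_op n m.
Proof. by move=> fit_m; rewrite /op_of /= encodeK. Qed.

Lemma here_idle cf i k m :
  here cf i k m -> fits (4 * n) m -> phase_op n m = NoOp -> idle cf i.
Proof. by move=> [cr cfi] fit_m op_m s; rewrite cfi => -[<-]; rewrite op_ofE. Qed.

Lemma gone_idle cf i : agents cf i = None -> idle cf i.
Proof. by move=> cfi s; rewrite cfi. Qed.

Lemma idle_requests cf i v : idle cf i -> requests ids cf i v = false.
Proof. by rewrite /requests /idle; case: (agents cf i) => // s ->; rewrite ?andbF. Qed.

Lemma idle_drops cf i v : idle cf i -> drops ids cf i v = false.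
Proof. by rewrite /drops /idle; case: (agents cf i) => // s ->; rewrite ?andbF. Qed.

(** * Rounds in which at most one agent handles pebbles *)

Section OneOperator.

Variables (p : 'S_3) (x : 'I_3) (cf : config n 3 (memory A)).
Hypothesis others_idle : forall i, i != x -> idle cf i.

(** Without competitors, a request succeeds exactly when a pebble is present, whatever the
    priorities. *)
Lemma sole_picks v : picks ids p cf x v = requests ids cf x v && (0 < pebbles cf v).
Proof.
rewrite /picks; congr (_ && (_ < _)); apply: eq_card0 => i; rewrite !inE.
have [->|ix] := eqVneq i x; first by rewrite ltnn andbF.
by rewrite idle_requests //; apply: others_idle.
Qed.

Lemma sole_pebbles v : pebbles (team_step ids p cf) v =
  pebbles cf v - (requests ids cf x v && (0 < pebbles cf v)) + drops ids cf x v.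
Proof.
have card_sole (f : pred 'I_3) : (forall i, i != x -> ~~ f i) -> #|[set i | f i]| = f x.
  move=> f_x; case fx: (f x).
    apply/eqP/cards1P; exists x; apply/setP => i; rewrite !inE.
    by apply/idP/eqP => [fi|->//]; apply: contraTeq fi => /f_x.
  apply: eq_card0 => i; rewrite inE; have [->//|/f_x/negbTE //] := eqVneq i x.
rewrite /= -sole_picks; congr (_ - _ + _); apply: card_sole => i /others_idle idle_i.
  by rewrite /picks idle_requests.
by rewrite idle_drops.
Qed.

Lemma ferry_requests k t cr v : agents cf x = Some (St k (Ferry t) cr) -> t <= 4 * n ->
  requests ids cf x v = [&& nd k == v, ~~ cr & t %% 3 == 2].
Proof.
move=> cfx le_t; rewrite /requests cfx op_ofE //=.
by do 2!congr (_ && _); do 2?case: ifP.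
Qed.

Lemma ferry_drops k t cr v : agents cf x = Some (St k (Ferry t) cr) -> t <= 4 * n ->
  drops ids cf x v = [&& nd k == v, cr, t %% 3 == 0 & t != 3 * n - 3].
Proof.
move=> cfx le_t; rewrite /drops cfx op_ofE //=.
by do 2!congr (_ && _); case: ifP => [/eqP->|] //; case: ifP.
Qed.

Lemma ferry_next j l k q t cr m' d : uniq [:: x; j; l] ->
  agents cf x = Some (St k (Ferry t) cr) -> t <= 4 * n ->
  let h := if cr then ~~ ((t %% 3 == 0) && (t != 3 * n - 3))
           else (t %% 3 == 2) && (0 < pebbles cf (nd k)) in
  (forall fst lst, program n fst lst
     (at_node cf j (nd k) + at_node cf l (nd k)) (pebbles cf (nd k)) h (Ferry t) = (m', d)) ->
  neighbour (nd k) d = nd q ->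
  agents (team_step ids p cf) x = Some (St q m' h).
Proof.
move=> xjl cfx le_t h prog_h kq; rewrite (team_stepE _ cfx) //.
rewrite (card_ids_seen _ _ xjl) sole_picks (ferry_requests _ cfx) // (ferry_drops _ cfx) //.
have -> : [&& nd k == nd k, ~~ cr & t %% 3 == 2] && (0 < pebbles cf (nd k))
    || cr && ~~ [&& nd k == nd k, cr, t %% 3 == 0 & t != 3 * n - 3] = h.
  by rewrite /h eqxx; case: (cr) => //=; rewrite orbF.
by rewrite prog_h /= kq.
Qed.

End OneOperator.

(** * The effect of a hole at node [w] *)

Section Adversary.

Variables (w : nat) (adv : adversary) (arb : nat -> 'S_3).
Hypothesis w_bounds : 0 < w < n.

Local Notation run_at t := (run A ids home (nd w) 2 adv arb t).
Local Notation struck u cf := (strike (nd w) adv u cf).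

Let home_w : 0 != w. Proof. by lia. Qed.

Lemma hitE k : k <= n -> (nd k == nd w) = (k == w).
Proof. by move=> le_kn; rewrite nd_eq; lia. Qed.

Lemma St_here cf i k m cr : agents cf i = Some (St k m cr) -> here cf i k m.
Proof. by exists cr. Qed.

Lemma St_struck u cf i k m cr : k <= n -> ~~ (active adv u && (k == w)) ->
  agents cf i = Some (St k m cr) -> agents (struck u cf) i = Some (St k m cr).
Proof.
by move=> le_kn spared cfi; apply: strike_survivor cfi _; rewrite hitE //; apply: negbTE.
Qed.

Lemma here_spared u cf i k m : k <= n -> ~~ (active adv u && (k == w)) ->
  here cf i k m -> here (struck u cf) i k m.
Proof. by move=> le_kn spared [cr cfi]; exists cr; apply: St_struck. Qed.

Lemma here_struck u cf i k m : k <= n -> here cf i k m -> k != w ->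
  here (struck u cf) i k m.
Proof. by move=> le_kn cfi kw; apply: here_spared; rewrite // negb_and kw orbT. Qed.

Lemma here_killed u cf i k m : active adv u -> here cf i k m -> k = w ->
  agents (struck u cf) i = None.
Proof. by move=> on [cr cfi] kw; apply: strike_victim cfi on _; rewrite /= kw. Qed.

Lemma pebbles_struck u cf k : k < n -> k != w ->
  pebbles (struck u cf) (nd k) = pebbles cf (nd k).
Proof. by move=> lt_kn kw; rewrite /= hitE 1?ltnW // (negbTE kw) !andbF. Qed.

Variable v : nat.
Hypothesis v_n : v < n.
Hypothesis v_w : v != w.

Variable T : nat.

(** The goal for a fixed node [v] and a fixed round [T]. The bound [t] makes it inherited by earlier
    rounds, as the liveness lemmas require. *)
Definition visited_after t :=
  exists t', [/\ t <= t', T <= t' & exists i, at_node (run_at t') i (nd v)].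

Lemma visited_prev t : visited_after t.+1 -> visited_after t.
Proof. by move=> [t' [lt_t le_T vis]]; exists t'; split=> //; apply: ltnW. Qed.

Lemma visited_now t i m : T <= t -> here (run_at t) i v m -> visited_after t.
Proof. by move=> le_T i_v; exists t; split=> //; exists i; rewrite (at_here _ i_v). Qed.

(** The final stage: the walk with turning points w - 1 and w + 1 never meets the hole and covers
    all the other nodes. *)
Lemma solo_visits i s t : s < L ->
  here (run_at t) i (wpos (w - 1) (w + 1) s) (Walk (w - 1) (w + 1) s) ->
  visited_after t.
Proof.
have lt_w : w - 1 < w + 1 <= n by lia.
have v_side : v <= w - 1 \/ w + 1 <= v by lia.
have [g lt_g gv] := walk_pos_visits n_gt2 lt_w v_n v_side.
pose Q s t := here (run_at t) i (wpos (w - 1) (w + 1) s) (Walk (w - 1) (w + 1) s).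
move: s t; apply: (@cycle_reaches L g T Q) => // [t|t le_T|s t lt_s].
- exact: visited_prev.
- by rewrite /Q gv; apply: visited_now.
move=> Qst; left; apply: walk_next => //; apply: here_struck Qst _.
  by rewrite /walk_pos; do ?case: ifP; lia.
by rewrite /walk_pos; do ?case: ifP; lia.
Qed.

(** * Keeper [a], ferry [x] and lead [y]: from the lead's suspicion to the exact position *)

Variables a x y : 'I_3.
Hypothesis axy : uniq [:: a; x; y].

Let xay : uniq [:: x; a; y].
Proof. by move: axy; rewrite /= !inE !negb_or (eq_sym x a); case/andP=> /andP[-> ->] /andP[-> _]. Qed.

Let yax : uniq [:: y; a; x].
Proof.
by move: axy; rewrite /= !inE !negb_or (eq_sym y a) (eq_sym y x); case/andP=> /andP[-> ->] /andP[-> _].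
Qed.

Lemma watch_next p cf tau : 0 < tau < P -> here cf a 0 (Watch tau) ->
  here (team_step ids p cf) a 0 (Watch (tick P tau)).
Proof.
move=> tau_P a1.
apply: (@here_next _ _ _ _ _ 0 _ _ _ Stay axy a1) => [|? ? ?|//]; first by rewrite /=; lia.
by rewrite /= (_ : (tau != 0)) //; lia.
Qed.

Lemma watch_idle cf tau : tau < P -> here cf a 0 (Watch tau) -> idle cf a.
Proof. by move=> tau_P a1; apply: here_idle a1 _ _ => //=; lia. Qed.

Lemma lead_idle cf k tau : tau < P -> here cf y k (Lead tau) -> idle cf y.
Proof. by move=> tau_P y1; apply: here_idle y1 _ _ => //=; lia. Qed.

Lemma lead_waits p cf k tau : 0 < tau < P -> tau %% 3 != 1 -> here cf y k (Lead tau) ->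
  here (team_step ids p cf) y k (Lead (tick P tau)).
Proof.
move=> tau_P tau3 y1.
apply: (@here_next _ _ _ _ _ k _ _ _ Stay yax y1) => [|? ? ?|//]; first by rewrite /=; lia.
by rewrite /= (negbTE tau3) (_ : (tau == 0) = false) //; lia.
Qed.

(* The lead and the ferry are dead, and the keeper has to draw the conclusions at
   date 2n + 2(j - 1) if the hole is at j - 1, at date 0 if it is at j. *)
Definition lost j s t := [/\ agents (run_at t) x = None, agents (run_at t) y = None &
  here (run_at t) a 0 (Guard j s)].

Lemma lost_next j s t : 0 < j < n -> s < L -> s != 0 -> s != 2 * n + 2 * (j - 1) ->
  lost j s t -> lost j (tick L s) t.+1.
Proof.
move=> j_n lt_s s0 sj [x0 y0 a0].
have [x1 y1] := (strike_gone (nd w) adv t x0, strike_gone (nd w) adv t y0).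
have a1 := here_struck t (leq0n n) a0 home_w.
split; [exact: step_gone|exact: step_gone|].
apply: (@here_next _ _ _ _ _ 0 _ _ _ Stay axy a1) => [|? ? ?|//]; first by rewrite /=; lia.
by rewrite /= (negbTE s0) (negbTE sj) !andbF.
Qed.

Lemma lost_end j s t : 0 < j < n -> lost j s t ->
  (s == 0) && (w == j) || (s == 2 * n + 2 * (j - 1)) && (w == j - 1) ->
  visited_after t.
Proof.
move=> j_n [x0 y0 a0] sw.
have [x1 y1] := (strike_gone (nd w) adv t x0, strike_gone (nd w) adv t y0).
have a1 := here_struck t (leq0n n) a0 home_w.
apply/visited_prev/(@solo_visits a 0); first by lia.
apply: (@here_next _ _ _ _ _ 0 _ _ _ Stay axy a1) => [|? ? ?|]; first by rewrite /=; lia.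
  rewrite (at_gone _ x1) (at_gone _ y1) /=.
  case/orP: sw => /andP[/eqP-> /eqP->].
    by rewrite (_ : (0 == _) = false) //; lia.
  by rewrite eqxx; congr (Walk _ _ _, _); lia.
by rewrite /walk_pos (_ : 0 < 2 * n) //; lia.
Qed.

(** The lead dies at j - 1 on its right trip or at j on its left trip. In either case the first
    check still ahead of the keeper is the one that draws the right conclusion. *)
Lemma lost_visits j s t : 0 < j < n -> s < L ->
  (2 * n < s <= 2 * n + 2 * (j - 1)) && (w == j - 1)
    || ((s == 0) || (2 * n + 2 * (j - 1) < s)) && (w == j) ->
  lost j s t -> visited_after t.
Proof.
have [-> j_n _ wj lost0|s0] := eqVneq s 0.
  by apply: lost_end lost0 _ => //; lia.
rewrite orFb => j_n lt_s /orP[/andP[s_j /eqP wj]|/andP[s_j /eqP wj]] lost_s.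
  have le_s : s <= 2 * n + 2 * (j - 1) by lia.
  pose Q r t := 2 * n < r /\ lost j r t.
  have Qs : Q s t by split=> //; lia.
  move: s t le_s Qs {lt_s s0 s_j lost_s}.
  apply: (line_reaches (Q := Q)) => [t|t [_ lost_t]|s t lt_s [gt_s lost_s]].
  - exact: visited_prev.
  - by apply: lost_end lost_t _ => //; rewrite wj !eqxx orbT.
  left; split; first by lia.
  have -> : s.+1 = tick L s by rewrite /tick; case: ifP; lia.
  by apply: lost_next lost_s; lia.
(* The date is allowed to run up to [L], which stands for date 0 of the next cycle. *)
pose Q r t := 2 * n + 2 * (j - 1) < r /\ lost j (if r == L then 0 else r) t.
have Qs : Q s t by split=> //; rewrite (ltn_eqF lt_s).
move: s t {lt_s s0 lost_s s_j} (ltnW lt_s) Qs.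
apply: (line_reaches (Q := Q)) => [t|t [_]|s t lt_s [gt_s]].
- exact: visited_prev.
- by rewrite eqxx => lost_t; apply: lost_end lost_t _ => //; rewrite wj !eqxx.
rewrite (ltn_eqF lt_s) => lost_s; left; split; first by lia.
have -> : (if s.+1 == L then 0 else s.+1) = tick L s by [].
by apply: lost_next lost_s; lia.
Qed.

Definition guarded j s t := [/\ agents (run_at t) x = None,
  here (run_at t) a 0 (Guard j s) &
  here (run_at t) y (wpos (j - 1) j s) (Walk (j - 1) j s)].

Lemma guarded_next j s t : 0 < j < n -> (w == j - 1) || (w == j) -> s < L ->
  guarded j s t -> guarded j (tick L s) t.+1 \/ visited_after t.+1.
Proof.
move=> j_n wj lt_s [x0 a0 y0].
have x1 := strike_gone (nd w) adv t x0.
have a1 := here_struck t (leq0n n) a0 home_w.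
have le_pos : wpos (j - 1) j s <= n by rewrite /walk_pos; do ?case: ifP; lia.
(* The keeper draws a conclusion only if the lead is missing at one of the two check dates, when a
   living lead is at home. *)
have a2 : (s == 0) || (s == 2 * n + 2 * (j - 1)) ==> (at_node (struck t (run_at t)) y (nd 0)) ->
    here (run_at t.+1) a 0 (Guard j (tick L s)).
  move=> present.
  apply: (@here_next _ _ _ _ _ 0 _ _ _ Stay axy a1) => [|? ? ?|//]; first by rewrite /=; lia.
  move: present; rewrite (at_gone _ x1) add0n; case: (at_node _ y _) => //=.
  by rewrite implybF negb_or => /andP[/negbTE-> /negbTE->].
have [y1|] := boolP (active adv t && (wpos (j - 1) j s == w)); last first.
  move=> spared.
  have y1 := here_spared le_pos spared y0.
  left; split; first exact: step_gone.
    apply: a2; rewrite (at_here _ y1) nd_eq //; apply/implyP => /orP[]/eqP->.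
      by rewrite /walk_pos; do ?case: ifP; lia.
    by rewrite /walk_pos; do ?case: ifP; lia.
  by apply: walk_next => //; lia.
case/andP: y1 => on /eqP y_w; right.
have y1 := here_killed on y0 y_w.
have s_bounds : (2 * n < s < 2 * n + 2 * (j - 1)) && (w == j - 1)
    || (2 * n + 2 * (j - 1) < s) && (w == j).
  by move: y_w wj; rewrite /walk_pos; do ?case: ifP; lia.
have lost_s : lost j (tick L s) t.+1.
  by split; [exact: step_gone|exact: step_gone|apply: a2; apply/implyP; lia].
by apply: lost_visits lost_s; rewrite // /tick; case: ifP; lia.
Qed.

(** With consecutive turning points j - 1 and j, the lead's walk covers the whole ring for as long
    as it survives. *)
Lemma guarded_visits j s t : 0 < j < n -> (w == j - 1) || (w == j) -> s < L ->
  guarded j s t -> visited_after t.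
Proof.
move=> j_n wj.
have lt_j : j - 1 < j <= n by lia.
have v_side : v <= j - 1 \/ j <= v by lia.
have [g lt_g gv] := walk_pos_visits n_gt2 lt_j v_n v_side.
move: s t; apply: (@cycle_reaches L g T (guarded j)) => // [t|t le_T [_ _]|s t lt_s].
- exact: visited_prev.
- by rewrite gv; apply: visited_now.
exact: guarded_next.
Qed.

(* [th] counts the rounds from the beginning of the last tour.  The lead, which missed
   the ferry at th = 3j + 1, is in [Walk (j - 1) j] at th = 3j + 2, on its way back
   from j at node j + 1: this fixes the shift between the two dates.  It leaves home
   at date 2n, hence is missed by the keeper at th = (3n - 2) + 2j + 4. *)
Definition pair_clock (j th : nat) :=
  if th + 3 * n - 2 * j - 3 < L then th + 3 * n - 2 * j - 3
  else th + 3 * n - 2 * j - 3 - L.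

Definition keeper_phase th :=
  if th < P then Watch th else if th == P then Watch 0 else Listen (th - P).

Definition paired j th t := [/\ 3 * j + 2 <= th, agents (run_at t) x = None,
  here (run_at t) a 0 (keeper_phase th) &
  here (run_at t) y (wpos (j - 1) j (pair_clock j th)) (Walk (j - 1) j (pair_clock j th))].

Lemma paired_next j th t : 0 < j < n -> (w == j - 1) || (w == j) ->
  th < P + 2 * j + 4 -> paired j th t -> paired j th.+1 t.+1.
Proof.
move=> j_n wj lt_th [ge_th x0 a0 y0].
have x1 := strike_gone (nd w) adv t x0.
have a1 := here_struck t (leq0n n) a0 home_w.
have le_pos : wpos (j - 1) j (pair_clock j th) <= n.
  by rewrite /walk_pos; do ?case: ifP; lia.
(* Up to its next departure the lead only goes home from j + 1, away from j, and waits there; it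
   meets neither j - 1 nor j. *)
have pos_w : wpos (j - 1) j (pair_clock j th) != w.
  by move: wj; rewrite /walk_pos /pair_clock; case: ifP; do ?case: ifP; lia.
have y1 := here_struck t le_pos y0 pos_w.
split; [by lia|exact: step_gone| |].
  apply: (@here_next _ _ _ _ _ 0 _ _ _ Stay axy a1) => [|? ? ?|//].
    by rewrite /keeper_phase; do ?case: ifP => /=; lia.
  rewrite (at_gone _ x1) (at_here _ y1) add0n nd_eq // /keeper_phase.
  have [lt_P|ge_P] := ltnP th P.
    rewrite /= (_ : (th != 0)); last by lia.
    by rewrite /tick ltn_neqAle lt_P andbT; case: eqP.
  rewrite (_ : (th.+1 < P) = false); last by lia.
  rewrite (_ : (th.+1 == P) = false); last by lia.
  rewrite walk_pos_home; last by rewrite /pair_clock; case: ifP; lia.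
  by have [->|_] := eqVneq th P; rewrite ?subSnn ?subSn.
have lt_clock : pair_clock j th < L by rewrite /pair_clock; case: ifP; lia.
have -> : pair_clock j th.+1 = tick L (pair_clock j th).
  by rewrite /tick /pair_clock; case: ifP; case: ifP; case: ifP; lia.
by apply: walk_next => //; lia.
Qed.

Lemma paired_end j t : 0 < j < n -> (w == j - 1) || (w == j) ->
  paired j (P + 2 * j + 4) t -> visited_after t.
Proof.
move=> j_n wj [_ x0]; set th := P + _ + _.
have -> : pair_clock j th = 2 * n + 1 by rewrite /pair_clock /th; case: ifP; lia.
have -> : keeper_phase th = Listen (2 * j + 4).
  by rewrite /keeper_phase /th; do ?case: ifP; try lia; move=> _ _; congr Listen; lia.
move=> a0 y0.
have x1 := strike_gone (nd w) adv t x0.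
have a1 := here_struck t (leq0n n) a0 home_w.
have le_pos : wpos (j - 1) j (2 * n + 1) <= n by rewrite /walk_pos; do ?case: ifP; lia.
have lt_L : 2 * n + 2 < L by lia.
have a2 : at_node (struck t (run_at t)) y (nd 0) = false ->
    here (run_at t.+1) a 0 (Guard j (2 * n + 2)).
  move=> absent.
  apply: (@here_next _ _ _ _ _ 0 _ _ _ Stay axy a1) => [|? ? ?|//]; first by rewrite /=; lia.
  (* The keeper decodes j from the length 2j + 4 of its wait, as (2j + 4 - 4) / 2. *)
  by rewrite (at_gone _ x1) absent /=; congr (Guard _ _, _); lia.
apply: visited_prev.
(* The lead may be destroyed in the very round in which the keeper notices its departure. *)
have [/andP[on /eqP y_w]|] := boolP (active adv t && (wpos (j - 1) j (2 * n + 1) == w)).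
  have y1 := here_killed on y0 y_w.
  apply: (@lost_visits j (2 * n + 2)) => //; last first.
    by split; [exact: step_gone|exact: step_gone|apply: a2; apply: at_gone].
  by move: y_w wj; rewrite /walk_pos; do ?case: ifP; lia.
move=> spared.
have y1 := here_spared le_pos spared y0.
apply: (@guarded_visits j (2 * n + 2)) => //; split; first exact: step_gone.
  by apply: a2; rewrite (at_here _ y1) nd_eq // /walk_pos; do ?case: ifP; lia.
have -> : 2 * n + 2 = tick L (2 * n + 1) by rewrite /tick; case: ifP; lia.
by apply: walk_next => //; lia.
Qed.

Lemma paired_visits j th t : 0 < j < n -> (w == j - 1) || (w == j) ->
  th <= P + 2 * j + 4 -> paired j th t -> visited_after t.
Proof.
move=> j_n wj; move: th t.
apply: (line_reaches (Q := paired j)) => [t|t|th t lt_th pair_th].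
- exact: visited_prev.
- exact: paired_end.
by left; apply: paired_next.
Qed.

(* The second pebble lies at [nd k0]; nothing is said of the black hole and beyond. *)
Definition trail k0 t := forall k, k < w -> pebbles (run_at t) (nd k) = (k == 0) + (k == k0).

Lemma idle_trail k0 t : (forall i, idle (struck t (run_at t)) i) -> trail k0 t -> trail k0 t.+1.
Proof.
move=> all_idle trail_t k lt_kw.
rewrite [LHS](@sole_pebbles _ x) //.
rewrite idle_requests // idle_drops // subn0 addn0 pebbles_struck ?trail_t //; lia.
Qed.

Lemma all_idle cf : idle cf a -> idle cf x -> idle cf y -> forall i, idle cf i.
Proof.
move=> idle_a idle_x idle_y i; have := mem_trio i axy.
by rewrite !inE => /or3P[]/eqP->.
Qed.

Lemma idle_except cf : idle cf a -> idle cf y -> forall i, i != x -> idle cf i.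
Proof.
move=> idle_a idle_y i ix; have := mem_trio i axy.
by rewrite !inE (negbTE ix) => /or3P[/eqP->||/eqP->].
Qed.

(** * Recovery when ferry and lead are both destroyed during a tour *)

Definition searching z t := [/\ agents (run_at t) x = None, agents (run_at t) y = None,
  here (run_at t) a z (Search z) & trail (w - 1) t].

(** The second pebble on w - 1 stops the keeper one step before the hole. If w = 1, it is recognized
    as a second pebble at home. *)
Lemma search_visits z t : z <= w - 1 -> searching z t -> visited_after t.
Proof.
move: z t; apply: line_reaches => [t|t|z t lt_z]; first exact: visited_prev.
  case=> x0 y0 a0 trail_t.
  have lt_n : w - 1 < n by lia.
  have neq_w : w - 1 != w by lia.
  have a1 := here_struck t (ltnW lt_n) a0 neq_w.
  apply/visited_prev/(@solo_visits a (2 * n + (w - 1))); first by lia.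
  apply: (@here_next _ _ _ _ _ (w - 1) _ _ _ Stay axy a1) => [|? ? ?|].
  - by rewrite /=; lia.
  - rewrite pebbles_struck // trail_t; last by lia.
    rewrite eqxx /= (_ : (_ < _ + 1)); last by lia.
    by congr (Walk _ _ _, _); lia.
  by congr (nd _); rewrite /walk_pos; do ?case: ifP; lia.
case=> x0 y0 a0 trail_t.
have [x1 y1] := (strike_gone (nd w) adv t x0, strike_gone (nd w) adv t y0).
have lt_n : z < n by lia.
have neq_w : z != w by lia.
have a1 := here_struck t (ltnW lt_n) a0 neq_w.
left; split; [exact: step_gone|exact: step_gone| |].
  apply: (@here_next _ _ _ _ _ z z.+1 _ _ GoRight axy a1) => [|? ? ?|//]; first by rewrite /=; lia.
  rewrite pebbles_struck // trail_t; last by lia.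
  by rewrite /= (_ : (z == w - 1) = false) ?addn0 ?ltnn //; lia.
apply: idle_trail => //; apply: all_idle; [|exact: gone_idle|exact: gone_idle].
by apply: here_idle a1 _ _ => //=; lia.
Qed.

(** The keeper, still unaware of the deaths, waits for the end of the tour; [tau = P] stands for
    date 0. *)
Definition doomed tau t := [/\ agents (run_at t) x = None, agents (run_at t) y = None,
  here (run_at t) a 0 (Watch (if tau == P then 0 else tau)) & 0 < tau /\ trail (w - 1) t].

Lemma doomed_visits tau t : tau <= P -> doomed tau t -> visited_after t.
Proof.
move: tau t; apply: line_reaches => [t|t|tau t lt_tau]; first exact: visited_prev.
  rewrite /doomed eqxx => -[x0 y0 a0 [_ trail_t]].
  have [x1 y1] := (strike_gone (nd w) adv t x0, strike_gone (nd w) adv t y0).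
  have a1 := here_struck t (leq0n n) a0 home_w.
  apply/visited_prev/(@search_visits 0) => //.
  split; [exact: step_gone|exact: step_gone| |].
    apply: (@here_next _ _ _ _ _ 0 _ _ _ Stay axy a1) => // ? ? ?.
    by rewrite (at_gone _ x1) (at_gone _ y1).
  apply: idle_trail => //; apply: all_idle; [|exact: gone_idle|exact: gone_idle].
  exact: here_idle a1 _ _.
rewrite /doomed (ltn_eqF lt_tau) => -[x0 y0 a0 [tau_gt0 trail_t]].
have [x1 y1] := (strike_gone (nd w) adv t x0, strike_gone (nd w) adv t y0).
have a1 := here_struck t (leq0n n) a0 home_w.
left; split; [exact: step_gone|exact: step_gone| |split=> //].
  by apply: watch_next a1; rewrite tau_gt0.
apply: idle_trail => //; apply: all_idle; [|exact: gone_idle|exact: gone_idle].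
by apply: here_idle a1 _ _ => //=; lia.
Qed.

(** * Recovery when the ferry or the lead is destroyed first *)

Definition tour_clock th := if th == P then 0 else th.

Definition ferry_dead j th t := [/\ agents (run_at t) x = None,
  here (run_at t) a 0 (Watch (tour_clock th)) &
  here (run_at t) y j.+1 (Lead (tour_clock th))].

Lemma ferry_dead_missed j t : 0 < j < n -> (w == j - 1) || (w == j) ->
  ferry_dead j (3 * j + 1) t -> visited_after t.
Proof.
move=> j_n wj [x0 a0 y0].
have x1 := strike_gone (nd w) adv t x0.
have a1 := here_struck t (leq0n n) a0 home_w.
have lt_jn : j < n by lia.
have jw : j.+1 != w by lia.
have y1 := here_struck t lt_jn y0 jw.
apply/visited_prev/(@paired_visits j (3 * j + 2)) => //; first by lia.
(* When j = n - 1 the lead waits for the ferry at home itself: lead and keeper notice its absence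
   together, at date 0. *)
have [lt_j|ge_j] := ltnP j.+1 n; last first.
  have jE : j = n - 1 by lia.
  have clockE : tour_clock (3 * j + 1) = 0 by rewrite /tour_clock; case: ifP; lia.
  have keeperE : keeper_phase (3 * j + 2) = Listen 1.
    rewrite /keeper_phase (_ : (_ < _) = false) 1?(_ : (_ == _) = false); try lia.
    by congr Listen; lia.
  have pair_clockE : pair_clock j (3 * j + 2) = 0 by rewrite /pair_clock; case: ifP; lia.
  rewrite clockE in a1 y1; split=> //; first exact: step_gone.
    rewrite keeperE; apply: (@here_next _ _ _ _ _ 0 _ _ _ Stay axy a1) => // ? ? ?.
    rewrite (at_gone _ x1) (at_here _ y1) nd_eq // (_ : (_ || _)) //; lia.
  rewrite pair_clockE walk_pos_home //.
  apply: (@here_next _ _ _ _ _ j.+1 _ _ _ Stay yax y1) => // [? ? ?|].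
    rewrite (at_gone _ x1) (at_here _ a1) nd_eq // (_ : (_ || _)); last by lia.
    by rewrite /=; congr (Walk _ _ _, _); lia.
  by rewrite -ndn; congr nd; lia.
have clockE : tour_clock (3 * j + 1) = 3 * j + 1 by rewrite /tour_clock; case: ifP; lia.
have keeperE : keeper_phase (3 * j + 2) = Watch (3 * j + 2).
  by rewrite /keeper_phase (_ : _ < _) //; lia.
have pair_clockE : pair_clock j (3 * j + 2) = 3 * n + j - 1.
  by rewrite /pair_clock; case: ifP; lia.
have posE : wpos (j - 1) j (3 * n + j - 1) = j.+1.
  by rewrite /walk_pos; do ?case: ifP; lia.
rewrite clockE in a1 y1; split=> //; first exact: step_gone.
  have -> : keeper_phase (3 * j + 2) = Watch (tick P (3 * j + 1)).
    by rewrite keeperE /tick; case: ifP; [lia|move=> _; congr Watch; lia].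
  by apply: watch_next a1; lia.
rewrite pair_clockE posE.
apply: (@here_next _ _ _ _ _ j.+1 _ _ _ Stay yax y1) => [|? ? ?|//].
  by rewrite /=; lia.
rewrite (at_gone _ x1) (at_here _ a1) nd_eq // (_ : (_ || _) = false); last by lia.
rewrite /= (_ : (_ == 0) = false); last by lia.
rewrite (_ : (_ == 1)); last by lia.
by rewrite (_ : (3 * j + 1 + 2) %/ 3 - 1 = j) //; lia.
Qed.

Lemma ferry_dead_visits j t : 0 < j < n -> (w == j - 1) || (w == j) ->
  ferry_dead j (3 * j) t -> visited_after t.
Proof.
move=> j_n wj [x0 a0 y0].
have x1 := strike_gone (nd w) adv t x0.
have a1 := here_struck t (leq0n n) a0 home_w.
have lt_jn : j < n by lia.
have jw : j.+1 != w by lia.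
have y1 := here_struck t lt_jn y0 jw.
have clockE : tour_clock (3 * j) = 3 * j by rewrite /tour_clock; case: ifP; lia.
have clockE' : tour_clock (3 * j + 1) = tick P (3 * j) by rewrite /tour_clock /tick addn1.
have tau_P : 0 < 3 * j < P by lia.
rewrite clockE in a1 y1.
apply/visited_prev/(ferry_dead_missed j_n wj); split; first exact: step_gone.
  by rewrite clockE'; apply: watch_next.
by rewrite clockE'; apply: lead_waits; rewrite // (_ : _ %% 3 = 0) //; lia.
Qed.

(** The ferry arrives at the hole that took the lead. Either it dies too, leaving the pebble on w -
    1 for the keeper, or it finds nobody there, knows that it stands on the hole, and steps back. *)
Lemma lead_dead_missed j t : 0 < j -> w = j.+1 ->
  agents (run_at t) y = None -> here (run_at t) a 0 (Watch (3 * j + 1)) ->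
  here (run_at t) x j.+1 (Ferry (3 * j + 1)) -> trail j t -> visited_after t.
Proof.
move=> j_gt0 wj y0 a0 x0 trail_t.
have y1 := strike_gone (nd w) adv t y0.
have a1 := here_struck t (leq0n n) a0 home_w.
have lt_jn : j.+1 < n by lia.
apply: visited_prev; case on : (active adv t).
  have x1 := here_killed on x0 (esym wj).
  apply: (@doomed_visits (3 * j + 2)); first by lia.
  split; [exact: step_gone|exact: step_gone| |split; first by lia].
    rewrite (_ : (_ == _) = false); last by lia.
    have -> : 3 * j + 2 = tick P (3 * j + 1) by rewrite /tick; case: ifP; lia.
    by apply: watch_next a1; lia.
  rewrite wj subn1 /=; apply: idle_trail => //.
  apply: all_idle; [|exact: gone_idle|exact: gone_idle].
  by apply: here_idle a1 _ _ => //=; lia.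
have spared : ~~ (active adv t && (j.+1 == w)) by rewrite on.
have x1 := here_spared (ltnW lt_jn) spared x0.
apply: (@solo_visits x (2 * n + w - 1)); first by lia.
apply: (@here_next _ _ _ _ _ j.+1 _ _ _ GoLeft xay x1) => [|? ? ?|].
- by rewrite /=; lia.
- rewrite (at_gone _ y1) (at_here _ a1) nd_eq //; last by lia.
  rewrite (_ : (_ || _) = false); last by lia.
  rewrite /= (_ : (_ == 0) = false); last by lia.
  rewrite (_ : (_ == 1)); last by lia.
  by rewrite (_ : (3 * j + 1 + 2) %/ 3 = w) //; lia.
by rewrite nd_left; congr nd; rewrite /walk_pos; do ?case: ifP; lia.
Qed.

Lemma lead_dead_visits j t : 0 < j -> w = j.+1 ->
  agents (run_at t) y = None -> here (run_at t) a 0 (Watch (3 * j)) ->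
  agents (run_at t) x = Some (St j (Ferry (3 * j)) true) ->
  (forall k, k < w -> pebbles (run_at t) (nd k) = (k == 0)) -> visited_after t.
Proof.
move=> j_gt0 wj y0 a0 x0 bare_t.
have y1 := strike_gone (nd w) adv t y0.
have a1 := here_struck t (leq0n n) a0 home_w.
have lt_jn : j.+1 < n by lia.
have le_jn : j <= n by lia.
have x1 : agents (struck t (run_at t)) x = Some (St j (Ferry (3 * j)) true).
  by apply: strike_survivor x0 _; rewrite hitE // (_ : (j == w) = false) ?andbF //; lia.
have others_idle : forall i, i != x -> idle (struck t (run_at t)) i.
  by apply: idle_except; [apply: here_idle a1 _ _ => //=; lia|exact: gone_idle].
have not_end : (3 * j == 0) = false /\ (3 * j).+1 != P by lia.
apply: visited_prev; apply: (lead_dead_missed j_gt0 wj); first exact: step_gone.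
- have -> : 3 * j + 1 = tick P (3 * j) by rewrite /tick (negbTE not_end.2) addn1.
  by apply: watch_next a1; lia.
- eexists; apply: (@ferry_next _ _ _ others_idle _ _ j j.+1 _ _ _ GoRight xay x1) => //.
    by lia.
  move=> ? ?; rewrite /= not_end.1 (_ : _ %% 3 = 0) /=; last by lia.
  by rewrite /tick (negbTE not_end.2) addn1.
move=> k lt_kw; rewrite [LHS](@sole_pebbles _ x) //.
have -> : requests ids (struck t (run_at t)) x (nd k) = false.
  by rewrite (ferry_requests _ x1) ?andbF //; lia.
have -> : drops ids (struck t (run_at t)) x (nd k) = (k == j).
  by rewrite (ferry_drops _ x1) ?nd_eq; lia.
by rewrite subn0 pebbles_struck ?bare_t //; lia.
Qed.

(** * The three rounds of a tour at node [j] *)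

Lemma pebbles_struck_hole u cf : pebbles (struck u cf) (nd w)
  = if active adv u && erase adv u then 0 else pebbles cf (nd w).
Proof. by rewrite /= eqxx andbT. Qed.

Definition gathered j t := [/\ here (run_at t) a 0 (Watch (3 * j - 2)),
  agents (run_at t) x = Some (St j (Ferry (3 * j - 2)) false),
  here (run_at t) y j (Lead (3 * j - 2)) &
  forall k, k < n -> pebbles (run_at t) (nd k) = (k == 0) + (k == j - 1)].

(* When [e] is false, the pebble of [nd (j - 1)] has just been erased. *)
Definition parted j t := exists2 e : bool, e || (w == j - 1) &
  [/\ here (run_at t) a 0 (Watch (3 * j - 1)),
  agents (run_at t) x = Some (St (j - 1) (Ferry (3 * j - 1)) false),
  here (run_at t) y j.+1 (Lead (3 * j - 1)) &
  forall k, k < n -> pebbles (run_at t) (nd k) = (k == 0) + (e && (k == j - 1))].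

Definition carrying j t := [/\ here (run_at t) a 0 (Watch (3 * j)),
  agents (run_at t) x = Some (St j (Ferry (3 * j)) true),
  here (run_at t) y j.+1 (Lead (3 * j)) &
  forall k, k < n -> pebbles (run_at t) (nd k) = (k == 0)].

Definition returned t := [/\ here (run_at t) a 0 (Watch 0),
  agents (run_at t) x = Some (St n (Ferry 0) true),
  here (run_at t) y n (Lead 0) &
  forall k, k < n -> pebbles (run_at t) (nd k) = (k == 0)].

Lemma gathered_next j t : 0 < j < n -> gathered j t ->
  parted j t.+1 \/ visited_after t.+1.
Proof.
move=> j_n [a0 x0 y0 peb_t].
have le_jn : j <= n by lia.
have tau_P : 0 < 3 * j - 2 < P by lia.
have tau3 : (3 * j - 2) %% 3 = 1 by lia.
have tickE : tick P (3 * j - 2) = 3 * j - 1 by rewrite /tick; case: ifP; lia.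
have tau0 : (3 * j - 2 == 0) = false by lia.
have fit_tau : 3 * j - 2 <= 4 * n by lia.
have lt_tauP : 3 * j - 2 < P by lia.
have a1 := here_struck t (leq0n n) a0 home_w.
have a2 := watch_next (arb t) tau_P a1.
have idle_a := watch_idle lt_tauP a1.
rewrite tickE in a2.
have [/andP[on /eqP jw]|spared] := boolP (active adv t && (j == w)).
  have x1 := here_killed on (St_here x0) jw.
  have y1 := here_killed on y0 jw.
  right; apply: (@doomed_visits (3 * j - 1)); first by lia.
  split; [exact: step_gone|exact: step_gone| |split; first by lia].
    by rewrite (_ : (_ == _) = false) //; lia.
  apply: idle_trail; first by apply: all_idle => //; apply: gone_idle.
  by move=> k lt_k; rewrite peb_t ?jw //; lia.
have x1 := St_struck le_jn spared x0.
have y1 := here_spared le_jn spared y0.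
have others_idle := idle_except idle_a (lead_idle lt_tauP y1).
(* In this round j - 1 is unoccupied, so the hole can erase the marker without destroying an
   agent. *)
left; exists (~~ [&& active adv t, erase adv t & w == j - 1]).
  by case: (w == j - 1); rewrite ?orbT // !andbF.
split=> //.
- rewrite (@ferry_next _ _ _ others_idle _ _ j (j - 1) _ _ (Ferry (3 * j - 1)) GoLeft xay x1) //.
  + by rewrite tau3.
  + move=> ? ?; rewrite (at_here _ y1) eqxx addn1 tau3 /= tau0 tau3 tickE.
    by [].
  + by rewrite nd_left_pos ?subn1 //; lia.
- apply: (@here_next _ _ _ _ _ j _ _ _ GoRight yax y1) => [|? ? ?|//]; first by rewrite /=; lia.
  by rewrite (at_here _ (St_here x1)) eqxx addn1 /= tau0 tau3 tickE.
move=> k lt_kn; rewrite [LHS](@sole_pebbles _ x) //.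
rewrite (ferry_requests _ x1) // (ferry_drops _ x1) // tau3 !andbF subn0 addn0.
have [->|kw] := eqVneq k w; last first.
  rewrite pebbles_struck // peb_t //.
  by have [<-|] := eqVneq k (j - 1); rewrite ?andbF // (eq_sym w) (negbTE kw) !andbF.
rewrite pebbles_struck_hole peb_t; last by lia.
by case: (active adv t); case: (erase adv t) => //=; case: (w == j - 1); lia.
Qed.

Lemma parted_next j t : 0 < j < n -> parted j t -> carrying j t.+1 \/ visited_after t.+1.
Proof.
move=> j_n [e e_w [a0 x0 y0 peb_t]].
have [le_jn lt_j1n] : j < n /\ j - 1 < n by lia.
have tau_P : 0 < 3 * j - 1 < P by lia.
have tau3 : (3 * j - 1) %% 3 = 2 by lia.
have tickE : tick P (3 * j - 1) = 3 * j by rewrite /tick; case: ifP; lia.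
have tau0 : (3 * j - 1 == 0) = false by lia.
have fit_tau : 3 * j - 1 <= 4 * n by lia.
have lt_tauP : 3 * j - 1 < P by lia.
have clockE : tour_clock (3 * j) = 3 * j by rewrite /tour_clock; case: ifP; lia.
have a1 := here_struck t (leq0n n) a0 home_w.
have a2 := watch_next (arb t) tau_P a1.
have idle_a := watch_idle lt_tauP a1.
rewrite tickE in a2.
have lead_next : here (struck t (run_at t)) y j.+1 (Lead (3 * j - 1)) ->
    here (run_at t.+1) y j.+1 (Lead (3 * j)).
  by move=> y1; rewrite -tickE; apply: lead_waits; rewrite ?tau3.
have [/andP[on /eqP jw]|spared] := boolP (active adv t && (j - 1 == w)).
  have x1 := here_killed on (St_here x0) jw.
  have jw' : j.+1 != w by lia.
  have y1 := here_struck t le_jn y0 jw'.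
  right; apply: (ferry_dead_visits j_n); first by rewrite jw eqxx.
  by split; rewrite ?clockE //; [exact: step_gone|exact: lead_next].
have x1 := St_struck (ltnW lt_j1n) spared x0.
(* The ferry survives at j - 1, so an active hole is elsewhere and finds no pebble to erase. *)
have peb1 k : k < n ->
    pebbles (struck t (run_at t)) (nd k) = (k == 0) + (e && (k == j - 1)).
  move=> lt_kn; have [kw|kw] := eqVneq k w; last by rewrite pebbles_struck ?peb_t.
  rewrite kw pebbles_struck_hole peb_t; last by lia.
  move: spared; rewrite (eq_sym _ w); case: (active adv t) => //= /negbTE->.
  by rewrite andbF; case: (erase adv t); lia.
have xE m' d : idle (struck t (run_at t)) y ->
    (forall fst lst o pb, program n fst lst o pb (0 < (j - 1 == 0) + e) (Ferry (3 * j - 1)) = (m', d)) ->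
    forall q, neighbour (nd (j - 1)) d = nd q -> here (run_at t.+1) x q m' /\
    agents (run_at t.+1) x = Some (St q m' (0 < (j - 1 == 0) + e)).
  move=> idle_y prog q kq.
  suff x2 : agents (run_at t.+1) x = Some (St q m' (0 < (j - 1 == 0) + e)).
    by split=> //; apply: St_here x2.
  have := @ferry_next (arb t) _ _ (idle_except idle_a idle_y) _ _ (j - 1) q _ _ m' d xay x1.
  by rewrite tau3 peb1 // !eqxx andbT; apply.
have peb2 : e -> idle (struck t (run_at t)) y ->
    forall k, k < n -> pebbles (run_at t.+1) (nd k) = (k == 0).
  move=> eT idle_y k lt_kn; rewrite [LHS](@sole_pebbles _ x) //; last exact: idle_except.
  rewrite (ferry_requests _ x1) // (ferry_drops _ x1) // tau3 !andbF addn0 andbT peb1 // eT.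
  by rewrite nd_eq; lia.
have x2 : e -> idle (struck t (run_at t)) y ->
    agents (run_at t.+1) x = Some (St j (Ferry (3 * j)) true).
  move=> eT idle_y; case: (xE (Ferry (3 * j)) GoRight idle_y _ j).
  - by move=> ? ? ? ?; rewrite eT addn1 /= tau0 tau3 tickE.
  - by rewrite [in RHS](_ : j = (j - 1).+1) //; lia.
  - by rewrite eT addn1.
have [/andP[on /eqP jw]|spared'] := boolP (active adv t && (j.+1 == w)).
  have y1 := here_killed on y0 jw.
  have eT : e by move: e_w; rewrite -jw; lia.
  right; apply: (@lead_dead_visits j) => //; first by lia.
  - exact: step_gone.
  - by apply: x2 => //; apply: gone_idle.
  - by move=> k lt_kw; apply: peb2 => //; [apply: gone_idle|lia].
have y1 := here_spared le_jn spared' y0.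
have idle_y := lead_idle lt_tauP y1.
case eT: e in e_w peb2 x2 xE.
  by left; split=> //; [apply: x2|apply: lead_next|apply: peb2].
(* The pebble is gone: the ferry knows that it stands on the hole, at j - 1, and leaves to the
   left. *)
right; rewrite orFb in e_w; have wj := eqP e_w.
apply: (@solo_visits x (2 * n + w - 1)); first by lia.
case: (xE (Walk (w - 1) (w + 1) (2 * n + w - 1)) GoLeft idle_y _ (w - 1)) => //.
- move=> ? ? ? ?; rewrite /= tau0 tau3 (_ : (0 < _) = false) /=; last by lia.
  by congr (Walk _ _ _, _); lia.
- by rewrite nd_left_pos; [congr nd|]; lia.
- have -> : wpos (w - 1) (w + 1) (2 * n + w - 1) = w - 1.
    by rewrite /walk_pos; do ?case: ifP; lia.
  by [].
Qed.

Lemma carrying_next j t : 0 < j < n -> carrying j t ->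
  (if j.+1 == n then returned t.+1 else gathered j.+1 t.+1) \/ visited_after t.+1.
Proof.
move=> j_n [a0 x0 y0 peb_t].
have [le_jn lt_jn] : j <= n /\ j < n by lia.
have tau_P : 0 < 3 * j < P by lia.
have tau3 : (3 * j) %% 3 = 0 by lia.
have tickE : tick P (3 * j) = tour_clock (3 * j + 1) by rewrite /tick /tour_clock addn1.
have tau0 : (3 * j == 0) = false by lia.
have fit_tau : 3 * j <= 4 * n by lia.
have lt_tauP : 3 * j < P by lia.
have a1 := here_struck t (leq0n n) a0 home_w.
have a2 := watch_next (arb t) tau_P a1.
have idle_a := watch_idle lt_tauP a1.
rewrite tickE in a2.
have lead_next : here (struck t (run_at t)) y j.+1 (Lead (3 * j)) ->
    here (run_at t.+1) y j.+1 (Lead (tour_clock (3 * j + 1))).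
  by move=> y1; rewrite -tickE; apply: lead_waits; rewrite ?tau3.
have [/andP[on /eqP jw]|spared] := boolP (active adv t && (j == w)).
  have x1 := here_killed on (St_here x0) jw.
  have jw' : j.+1 != w by lia.
  have y1 := here_struck t lt_jn y0 jw'.
  right; apply: (ferry_dead_missed j_n); first by rewrite jw eqxx orbT.
  by split; [exact: step_gone| |exact: lead_next].
have x1 := St_struck le_jn spared x0.
have peb1 k : k < n -> pebbles (struck t (run_at t)) (nd k) = (k == 0).
  move=> lt_kn; have [->|kw] := eqVneq k w; last by rewrite pebbles_struck ?peb_t.
  by rewrite pebbles_struck_hole peb_t; [case: ifP; lia|lia].
have x2 : idle (struck t (run_at t)) y -> agents (run_at t.+1) x
    = Some (St j.+1 (Ferry (tour_clock (3 * j + 1))) (j.+1 == n)).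
  move=> idle_y.
  rewrite (@ferry_next (arb t) _ _ (idle_except idle_a idle_y) _ _ j j.+1 _ _
    (Ferry (tour_clock (3 * j + 1))) GoRight xay x1) //.
    by rewrite tau3 eqxx /=; congr (Some (St _ _ _)); lia.
  by move=> ? ?; rewrite /= tau0 tau3 tickE.
have peb2 : idle (struck t (run_at t)) y -> forall k, k < n ->
    pebbles (run_at t.+1) (nd k) = (k == 0) + ((k == j) && (j.+1 != n)).
  move=> idle_y k lt_kn; rewrite [LHS](@sole_pebbles _ x) //; last exact: idle_except.
  rewrite (ferry_requests _ x1) // (ferry_drops _ x1) // tau3 !andbF subn0 peb1 // nd_eq; lia.
have [/andP[on /eqP jw]|spared'] := boolP (active adv t && (j.+1 == w)).
  have y1 := here_killed on y0 jw.
  have idle_y := gone_idle y1.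
  have clockE : tour_clock (3 * j + 1) = 3 * j + 1 by rewrite /tour_clock; case: ifP; lia.
  rewrite clockE in a2 x2; right; apply: (@lead_dead_missed j) => //; first by lia.
  - exact: step_gone.
  - by apply: St_here; apply: x2.
  - by move=> k lt_kw; rewrite peb2 //; lia.
have y1 := here_spared lt_jn spared' y0.
have idle_y := lead_idle lt_tauP y1.
left; case: ifP => [/eqP jn|jn].
  have clockE : tour_clock (3 * j + 1) = 0 by rewrite /tour_clock; case: ifP; lia.
  rewrite clockE in a2 x2 lead_next; split=> //.
  - by rewrite x2 // jn eqxx.
  - by move: (lead_next y1); rewrite jn.
  - by move=> k lt_kn; rewrite peb2 // jn eqxx andbF addn0.
have clockE : tour_clock (3 * j + 1) = 3 * j.+1 - 2 by rewrite /tour_clock; case: ifP; lia.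
rewrite clockE in a2 x2 lead_next; split=> //.
- by rewrite x2 // jn.
- exact: lead_next.
- by move=> k lt_kn; rewrite peb2 // jn andbT subn1.
Qed.

(** * Departure from home and repetition of the tours *)

Hypothesis ids_ax : ids a < ids x.
Hypothesis ids_xy : ids x < ids y.

(** When all are together, each compares its ID with the two it sees: smallest, middle and largest
    become keeper, ferry and lead, the same at every departure. *)
Lemma depart_step p cf i k m cr : (forall i, at_node cf i (nd k)) ->
  agents cf i = Some (St k m cr) -> fits (4 * n) m ->
  (forall f l pb h, program n f l 2 pb h m =
    if f then (Watch 1, Stay) else if l then (Lead 1, GoRight) else (Ferry 1, GoRight)) ->
  agents (team_step ids p cf) i =
  Some (let r := if i == a then (Watch 1, Stay) else if i == y then (Lead 1, GoRight)
                 else (Ferry 1, GoRight) in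
    AgentState (neighbour (nd k) r.2) (encode (4 * n) r.1 : memory A)
      (picks ids p cf i (nd k) || (cr && ~~ drops ids cf i (nd k)))).
Proof.
move=> all_home cfi fit_m prog; rewrite (team_stepE _ cfi fit_m).
set S := view_of _ _ _ _.
have seen z : z \in ids_seen S -> exists2 i', i' != i & z = ids i'.
  by move=> /imsetP[i']; rewrite inE => /andP[i'_i _] ->; exists i'.
have seenI i' : i' != i -> ids i' \in ids_seen S.
  by move=> i'_i; apply: imset_f; rewrite inE i'_i all_home.
have others2 : #|ids_seen S| = 2.
  have := mem_trio i axy; rewrite !inE => /or3P[]/eqP ii; move: axy xay yax; rewrite -ii => h1 h2 h3.
  - by rewrite (card_ids_seen _ _ h1) !all_home.
  - by rewrite (card_ids_seen _ _ h2) !all_home.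
  - by rewrite (card_ids_seen _ _ h3) !all_home.
have a_min i' : i' != a -> ids a < ids i'.
  have := mem_trio i' axy; rewrite !inE => /or3P[]/eqP-> //; first by rewrite eqxx.
  by rewrite (ltn_trans ids_ax).
have y_max i' : i' != y -> ids i' < ids y.
  have := mem_trio i' axy; rewrite !inE => /or3P[]/eqP-> //; last by rewrite eqxx.
  by rewrite (ltn_trans ids_ax).
have firstE : [forall z in ids_seen S, ids i < z] = (i == a).
  apply/forall_inP/eqP => [first_i|ia z /seen[i' i'i ->]]; last first.
    by rewrite ia a_min // -ia.
  apply/eqP/contraT => ia; have := first_i (ids a); rewrite seenI 1?eq_sym // => /(_ isT).
  by rewrite ltnNge ltnW // a_min.
have lastE : [forall z in ids_seen S, z < ids i] = (i == y).
  apply/forall_inP/eqP => [last_i|iy z /seen[i' i'i ->]]; last first.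
    by rewrite iy y_max // -iy.
  apply/eqP/contraT => iy; have := last_i (ids y); rewrite seenI 1?eq_sym // => /(_ isT).
  by rewrite ltnNge ltnW // y_max.
by rewrite others2 prog firstE lastE.
Qed.

(** In the departure round the ferry drops the pebble at home, restoring the two pebbles with which
    a tour starts. *)
Lemma returned_next t : returned t -> gathered 1 t.+1.
Proof.
move=> [a0 x0 y0 peb_t].
have nw : ~~ (active adv t && (n == w)) by rewrite negb_and (_ : n != w) ?orbT //; lia.
have zw : ~~ (active adv t && (0 == w)) by rewrite negb_and home_w orbT.
have a1 := here_spared (leq0n n) zw a0.
have x1 := St_struck (leqnn n) nw x0.
have y1 := here_spared (leqnn n) nw y0.
have P_gt0 : 0 < P by lia.
have others_idle := idle_except (watch_idle P_gt0 a1) (lead_idle P_gt0 y1).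
have all_home i : at_node (struck t (run_at t)) i (nd 0).
  have := mem_trio i axy; rewrite !inE => /or3P[]/eqP->.
  - by rewrite (at_here _ a1) eqxx.
  - by rewrite (at_here _ (St_here x1)) ndn eqxx.
  - by rewrite (at_here _ y1) ndn eqxx.
have all_home' i : at_node (struck t (run_at t)) i (nd n) by rewrite ndn.
have [xa xy ya] : [/\ x != a, x != y & y != a].
  by move: axy; rewrite /= !inE !negb_or andbT (eq_sym a x) (eq_sym a y) => /andP[/andP[-> ->] ->].
split.
- by case: a1 => cr a1; rewrite /here (depart_step _ all_home a1) // eqxx; eexists.
- rewrite (depart_step _ all_home' x1) //= (negbTE xa) (negbTE xy).
  rewrite (sole_picks _ others_idle) (ferry_requests _ x1) // (ferry_drops _ x1) // eqxx /=.
  rewrite (_ : (0 != 3 * n - 3)) /=; last by lia.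
  by rewrite -[ordS _]/(nd n.+1) /St; congr (Some (AgentState _ _ _)); rewrite /= ndn.
- case: y1 => cr y1; rewrite /here (depart_step _ all_home' y1) //= (negbTE ya) eqxx ndn.
  by eexists.
move=> k lt_kn; rewrite [LHS](@sole_pebbles _ x) //.
rewrite (ferry_requests _ x1) // (ferry_drops _ x1) // !andbF subn0.
have -> : pebbles (struck t (run_at t)) (nd k) = (k == 0).
  have [->|kw] := eqVneq k w; last by rewrite pebbles_struck ?peb_t.
  by rewrite pebbles_struck_hole peb_t; [case: ifP; lia|lia].
by rewrite nd_eq //; lia.
Qed.

Lemma start_next : gathered 1 1.
Proof.
have start_i i : agents (run_at 0) i = Some (St 0 (Watch 0) false) by [].
have zw : ~~ (active adv 0 && (0 == w)) by rewrite negb_and home_w orbT.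
have struck_i i := St_struck (leq0n n) zw (start_i i).
have idle_i i : idle (struck 0 (run_at 0)) i by apply: here_idle (St_here (struck_i i)) _ _.
have all_home i : at_node (struck 0 (run_at 0)) i (nd 0).
  by rewrite (at_here _ (St_here (struck_i i))) eqxx.
have [xa xy ya] : [/\ x != a, x != y & y != a].
  by move: axy; rewrite /= !inE !negb_or andbT (eq_sym a x) (eq_sym a y) => /andP[/andP[-> ->] ->].
have picks0 i : picks ids (arb 0) (struck 0 (run_at 0)) i (nd 0) = false.
  by rewrite /picks idle_requests.
split.
- by rewrite /here (depart_step _ all_home (struck_i a)) // eqxx; eexists.
- by rewrite (depart_step _ all_home (struck_i x)) // (negbTE xa) (negbTE xy) picks0.
- by rewrite /here (depart_step _ all_home (struck_i y)) // (negbTE ya) eqxx; eexists.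
move=> k lt_kn; rewrite [LHS](@sole_pebbles _ x) // idle_requests // idle_drops // subn0 addn0.
have peb0 : pebbles (run_at 0) (nd k) = (k == 0) + (k == 1 - 1).
  rewrite /= -[home]/(nd 0) nd_eq //; last by lia.
  by case: eqP => [->|] //=; case: ifP => //; lia.
have [kw|kw] := eqVneq k w; last by rewrite pebbles_struck.
rewrite kw pebbles_struck_hole -kw peb0; case: ifP; lia.
Qed.

Definition touring tau t := (tau == 0) /\ returned t \/ exists2 j, 0 < j < n &
  [\/ (tau == 3 * j - 2) /\ gathered j t, (tau == 3 * j - 1) /\ parted j t |
      (tau == 3 * j) /\ carrying j t].

Lemma touring_next tau t : touring tau t -> touring (tick P tau) t.+1 \/ visited_after t.+1.
Proof.
case=> [[/eqP-> /returned_next gath]|[j j_n [[/eqP-> gath]|[/eqP-> part]|[/eqP-> carr]]]].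
- left; right; exists 1; first by lia.
  by apply: Or31; split=> //; rewrite /tick; case: ifP; lia.
- have [part|] := gathered_next j_n gath; last by right.
  left; right; exists j => //; apply: Or32; split=> //.
  by rewrite /tick; case: ifP; lia.
- have [carr|] := parted_next j_n part; last by right.
  left; right; exists j => //; apply: Or33; split=> //.
  by rewrite /tick; case: ifP; lia.
have [|] := carrying_next j_n carr; last by right.
case: ifP => [jn ret|jn gath]; left; [left|right].
  by split=> //; rewrite /tick; case: ifP; lia.
exists j.+1; first by lia.
by apply: Or31; split=> //; rewrite /tick; case: ifP; lia.
Qed.

Lemma touring_visits tau t : tau < P -> touring tau t -> visited_after t.
Proof.
(* Home is visited by the keeper at date 0, and node v > 0 by the ferry at date 3v - 2, when it
   meets the lead there. *)
pose g := if v == 0 then 0 else 3 * v - 2.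
move: tau t; apply: (@cycle_reaches P g T) => [|t|t le_T|tau t _].
- by rewrite /g; case: ifP; lia.
- exact: visited_prev.
- rewrite /g; have [v0|v_gt0] := posnP v.
    case=> [[_ [a0 _ _ _]]|[j j_n]]; last by case=> -[/eqP g_j]; lia.
    by apply: (@visited_now t a (Watch 0)); rewrite // v0.
  case=> [[/eqP]|[j j_n]]; first by lia.
  case=> -[/eqP tau_j]; try by lia.
  case=> _ x0 _ _; have jv : j = v by lia.
  by move: x0; rewrite jv => /St_here; apply: visited_now.
exact: touring_next.
Qed.

End Adversary.
End Team.

(** * Instantiation for arbitrary IDs and nodes *)

Lemma sorted_trio N (f : 'I_3 -> 'I_N) : injective f ->
  exists a x y, [/\ uniq [:: a; x; y], f a < f x & f x < f y].
Proof.
move=> f_inj; pose r i j := f i <= f j; pose s := sort r (enum 'I_3).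
have r_total : total r by move=> i j; apply: leq_total.
have: sorted r s by apply: sort_sorted.
have: uniq s by rewrite sort_uniq enum_uniq.
have: size s = 3 by rewrite size_sort -cardE card_ord.
case: s => [|a [|x [|y []]]] // _ axy /= /and3P[ax xy _].
exists a, x, y; move: axy; rewrite /= !inE negb_or => /and3P[/andP[ax' ay'] xy' _].
have lt i j : i != j -> r i j -> f i < f j.
  by move=> ij le_ij; rewrite ltn_neqAle val_eqE inj_eq // ij.
by rewrite ax' ay' xy' !lt.
Qed.

Lemma ring_algorithm_solves c n :
  2 < n -> @solves_PerpExploration_BBH n 3 c 2 (ring_algorithm 3 c n).
Proof.
move=> n_gt2 ids home vb adv arb ids_inj home_vb _ node node_vb T.
have [w lt_w vbE] := nd_surj home vb; have [v lt_v nodeE] := nd_surj home node.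
have w_bounds : 0 < w < n.
  by rewrite lt_w andbT lt0n; apply: contraNneq home_vb => w0; rewrite vbE w0.
have v_w : v != w by apply: contraNneq node_vb => vw; rewrite nodeE vbE vw.
have [a [x [y [axy ids_ax ids_xy]]]] := sorted_trio ids_inj.
have gath := start_next home n_gt2 ids_inj adv arb w_bounds lt_v v_w axy ids_ax ids_xy.
have tour1 : touring ids home w adv arb a x y 1 1.
  by right; exists 1; [lia|apply: Or31].
have lt_P : 1 < 3 * n - 2 by lia.
have [t [_ le_Tt vis]] :=
  touring_visits n_gt2 ids_inj w_bounds lt_v v_w T axy ids_ax ids_xy lt_P tour1.
by exists t; rewrite vbE nodeE.
Qed.

Theorem theorem7 (c : nat) (hc : 0 < c) :
  (exists A : nat -> algorithm 3 c,
      log_memory A /\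
      forall n : nat, 3 <= n -> solves_PerpExploration_BBH n 2 (A n)) /\
  (forall (k : nat), k < 3 ->
   forall A : nat -> algorithm k c, log_memory A ->
   forall n : nat, 4 <= n -> ~ solves_PerpExploration_BBH n 2 (A n)).
Proof.
split.
  exists (ring_algorithm 3 c); split; first exact: ring_algorithm_log_memory.
  by move=> n; apply: ring_algorithm_solves.
by move=> k lt_k3 A _ n le_4n; apply: two_agents_fail.
Qed.
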